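(* Let $\alpha>1$, $a_j=j^{\alpha/2}$, and $X=\{x\in\mathbb{R}^{\mathbb{N}}:\sum_{j=1}^\infty a_j|x_j|\le1\}$. Then: (a) Minimax rate optimal estimation over $X$ in the Gaussian sequence model requires nonlinear estimators: as $\sigma\downarrow0$, $$\frac{R^*_\sigma(X)}{R^*_{\mathrm{lin},\sigma}(X)}\to0.$$ (b) Euclidean gradient methods are minimax rate optimal for stochastic optimization over $X$: there is a constant $C=C(\alpha)<\infty$ such that for every $k\ge1$ there is a diagonal scaling $\lambda=(\lambda_j)_{j\ge1}$, $\lambda_j>0$, for which the Euclidean gradient method with scaling $\lambda$ has worst-case average regret over $k$ rounds, relative to $X$ and over all loss functions with subgradients bounded by $1$ in $\ell_\infty$-norm, at most $C\,\mathfrak{M}^{\mathsf S}_k(X,\|\cdot\|_\infty)$.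
   Context: Gaussian sequence model: one observes $y=x+\xi$ with $x\in X$ unknown and $\xi$ having i.i.d. $\mathsf N(0,\sigma^2)$ coordinates. $R^*_\sigma(X)=\inf_{\hat x}\sup_{x\in X}\mathbb{E}_x\|\hat x(y)-x\|_2^2$ over all measurable estimators, and $R^*_{\mathrm{lin},\sigma}(X)$ is the same with the infimum restricted to linear estimators $\hat x=Ay$, $A$ a (measurable) linear operator on $\mathbb{R}^{\mathbb{N}}$. Stochastic optimization: let $E=\ell_1(\mathbb{N})\supset X$. For a measurable sample space $\mathcal{S}$, let $\mathcal{F}$ be the functions $F:E\times\mathcal{S}\to\mathbb{R}$, convex in the first argument and measurable in the second, with $\|g\|_\infty\le1$ for all $g\in\partial_xF(x,s)$, $x\in E$, $s\in\mathcal{S}$. For a distribution $P$ on $\mathcal{S}$ with $F(x,\cdot)$ $P$-integrable for all $x$, $f_P(x)=\int F(x,s)dP(s)$, and $$\mathfrak{M}^{\mathsf S}_k(X,\|\cdot\|_\infty)=\sup_{\mathcal{S}}\inf_{\hat x_k}\sup_{F\in\mathcal{F}}\sup_P\ \mathbb{E}\Big[f_P(\hat x_k)-\inf_{x\in X}f_P(x)\Big],$$ where $\hat x_k$ is any $E$-valued rule based on the observed functions $F(\cdot,S_1),\dots,F(\cdot,S_k)$, $S_i$ i.i.d. from $P$ (measurable in the samples for each $F$). The Euclidean gradient method with diagonal scaling $\lambda$ plays $x_1=0$, $x_{i+1}=x_i-(g_{i,j}/\lambda_j)_{j\ge1}$, $g_i\in\partial_xF(x_i,s_i)$; its average regret relative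 to $X$ is $\sup_{x\in X}\frac1k\sum_{i\le k}[F(x_i,s_i)-F(x,s_i)]$. *)

(* Defs.v *)
(* Coordinates are indexed from 0: the coordinate (or weight) of index [j : nat]
   here is the one of index [j + 1] in the mathematical text. *)
From HB Require Import structures.
From mathcomp Require Import all_boot all_order all_algebra.
From mathcomp Require Import all_classical all_reals all_analysis.

Set Implicit Arguments.
Unset Strict Implicit.
Unset Printing Implicit Defensive.

Import Order.TTheory GRing.Theory Num.Theory.
Import numFieldNormedType.Exports.

Local Open Scope classical_set_scope.
Local Open Scope ring_scope.

(* R^N with its product sigma-algebra. *)
Definition cylinders (R : realType) : set (set (nat -> R)) :=
  \bigcup_j preimage_set_system [set: nat -> R] (fun y => y j) measurable.

Notation seqspace R := (g_sigma_algebraType (@cylinders R)).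

Definition weighted_l1_ball (R : realType) (a : nat -> R) : set (nat -> R) :=
  [set x | (\sum_(0 <= j <oo) (a j * `|x j|)%:E <= 1)%E].

Section gaussian_sequence_model.
Context {R : realType}.
Implicit Types (mu : probability (seqspace R) R) (X : set (nat -> R)).

(* [mu] is the law of a sequence with i.i.d. N(0, s^2) coordinates: there is
   exactly one such law, determined by its values on cylinders.  The parameter
   [s] of [normal_prob m s] is the standard deviation. *)
Definition iid_gaussian (s : R) mu : Prop :=
  forall (n : nat) (B : nat -> set R), (forall j, measurable (B j)) ->
    mu [set y | forall j, (j < n)%N -> B j (y j)]
    = (\prod_(j < n) normal_prob 0 s (B j))%E.

Definition estimator : set (seqspace R -> seqspace R) :=
  [set h | measurable_fun setT h].

Definition linear_estimator : set (seqspace R -> seqspace R) :=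
  [set A | estimator A /\
     forall (c : R) (y z : seqspace R),
       A (fun j => c * y j + z j) = (fun j => c * A y j + A z j)].

(* E_x || h(y) - x ||_2^2 for y = x + xi, where xi has law [mu]. *)
Definition square_risk mu (h : seqspace R -> seqspace R) (x : nat -> R)
    : \bar R :=
  (\int[mu]_xi
     \sum_(0 <= j <oo) ((h (fun i => x i + xi i)%R j - x j) ^+ 2)%:E)%E.

Definition minimax_risk_over (H : set (seqspace R -> seqspace R)) mu X
    : \bar R :=
  ereal_inf [set ereal_sup [set square_risk mu h x | x in X] | h in H].

Definition minimax_risk := minimax_risk_over estimator.

Definition linear_minimax_risk := minimax_risk_over linear_estimator.

End gaussian_sequence_model.

(* E = l_1(N), as a vector subspace of the sequences. *)
Section ell1.
Context (R : realType).

Definition in_ell1 : {pred (nat -> R^o)} :=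
  mem [set x : nat -> R^o | summable [set: nat] (fun j => (x j)%:E)].

Record ell1 : Type := Ell1 { ell1_val :> nat -> R^o; _ : ell1_val \in in_ell1 }.

HB.instance Definition _ := [isSub for ell1_val].
HB.instance Definition _ := [Choice of ell1 by <:].

Lemma in_ell1_submod : submod_closed in_ell1.
Proof.
split=> [|c x y].
  by rewrite inE /= /summable esum1// => j _; rewrite abse0.
rewrite !inE /= => xl yl.
have cx : summable [set: nat] (fun j => (c * x j)%:E).
  rewrite /summable; under eq_esum do rewrite EFinM abseM.
  rewrite -nneseries_esumT; last by move=> j; rewrite mule_ge0.
  rewrite nneseriesZl; last by move=> j _; exact: abse_ge0.
  rewrite nneseries_esumT; last by move=> j; exact: abse_ge0.
  by move: xl; rewrite summableE => /fineK <-; rewrite -EFinM ltry.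
exact: (summableD cx yl).
Qed.

HB.instance Definition _ :=
  GRing.isSubmodClosed.Build R (nat -> R^o) in_ell1 in_ell1_submod.
HB.instance Definition _ := [SubChoice_isSubLmodule of ell1 by <:].

End ell1.

Section stochastic_optimization.
Context {R : realType}.
Implicit Types (f : ell1 R -> R) (x : ell1 R) (g lambda : nat -> R).

Definition linf_norm g : \bar R := ereal_sup (range (fun j => `|g j|%:E)).

(* The pairing of l_oo with l_1; the series converges absolutely when [g] is
   bounded. *)
Definition pairing g x : R := limn (series (fun j => g j * x j)).

(* Subgradients are elements of the dual of E, that is of l_oo. *)
Definition subdifferential f x : set (nat -> R) :=
  [set g | (linf_norm g < +oo)%E /\ forall y, f x + pairing g (y - x) <= f y].

(* The class of losses.  That subgradients exist at every point is part of the
   meaning of the bound: without it every nowhere continuous convex function,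
   e.g. an unbounded linear functional on E, would satisfy the bound vacuously.
   For finite convex functions on E, subdifferentiability everywhere amounts to
   continuity. *)
Definition loss_class d (S : measurableType d) : set (ell1 R -> S -> R) :=
  [set F | [/\ forall s, convex_function [set: ell1 R] (F ^~ s),
               forall x, measurable_fun [set: S] (F x),
               forall x s, subdifferential (F ^~ s) x !=set0
             & forall x s g, subdifferential (F ^~ s) x g ->
                 (linf_norm g <= 1)%E]].

Definition cons_tuple d (S : measurableType d) n (p : S * n.-tuple S)
  : n.+1.-tuple S := [tuple of p.1 :: p.2].

Lemma measurable_cons_tuple d (S : measurableType d) n :
  measurable_fun [set: S * n.-tuple S] (@cons_tuple d S n).
Proof. exact: measurable_cons. Qed.

HB.instance Definition _ d (S : measurableType d) n :=
  isMeasurableFun.Build _ _ _ _ (@cons_tuple d S n)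
    (measurable_cons_tuple (n := n)).

(* The law of (S_1, ..., S_k) for S_i i.i.d. from [P]. *)
Fixpoint iid_samples d (S : measurableType d) (P : probability S R) (k : nat)
    : probability (k.-tuple S) R :=
  match k with
  | 0 => dirac [tuple]
  | n.+1 => distribution (P \x iid_samples P n)%E (@cons_tuple d S n)
  end.

(* E is equipped with its Borel sigma-algebra, which is generated by the
   coordinates, whence measurability coordinate by coordinate. *)
Definition decision_rule d (S : measurableType d) (k : nat)
    : set (k.-tuple (ell1 R -> R) -> ell1 R) :=
  [set h | forall F, loss_class F -> forall j : nat,
     measurable_fun [set: k.-tuple S]
       (fun w => h [tuple of [seq (fun x => F x s) | s <- w]] j : R)].

Definition population_loss d (S : measurableType d) (P : probability S R)
    (F : ell1 R -> S -> R) x : \bar R :=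
  (\int[P]_s (F x s)%:E)%E.

Definition integrable_losses d (S : measurableType d) (F : ell1 R -> S -> R)
    : set (probability S R) :=
  [set P | forall x, P.-integrable [set: S] (fun s => (F x s)%:E)].

Definition optimality_gap d (S : measurableType d) (X : set (nat -> R))
    (P : probability S R) (F : ell1 R -> S -> R) x : \bar R :=
  (population_loss P F x
   - ereal_inf [set population_loss P F z | z in [set z : ell1 R | X z]])%E.

(* Unlike [\int[P]_w f w], for which oo - oo = -oo, an undefined expectation
   counts as an infinite loss: the subtraction is the dual one, for which
   oo - oo = +oo. *)
Definition expected_loss d (T : measurableType d) (P : probability T R)
    (f : T -> \bar R) : \bar R :=
  ((\int[P]_w (f^\+ w)%E)%E - (\int[P]_w (f^\- w)%E)%E)%dE.

Definition excess_risk d (S : measurableType d) (X : set (nat -> R)) (k : nat)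
    (h : k.-tuple (ell1 R -> R) -> ell1 R) (F : ell1 R -> S -> R)
    (P : probability S R) : \bar R :=
  expected_loss (iid_samples P k)
    (fun w => optimality_gap X P F (h [tuple of [seq (fun x => F x s) | s <- w]])).

Definition minimax_excess_on d (S : measurableType d) (X : set (nat -> R))
    (k : nat) : \bar R :=
  ereal_inf [set
    ereal_sup [set
      ereal_sup [set excess_risk X h F P | P in integrable_losses F]
    | F in @loss_class d S]
  | h in @decision_rule d S k].

(* The supremum ranges over all measurable sample spaces. *)
Definition minimax_stochastic (X : set (nat -> R)) (k : nat) : \bar R :=
  ereal_sup [set v | exists d (S : measurableType d),
                       v = minimax_excess_on S X k].

Definition gradient_step lambda x g (x' : ell1 R) : Prop :=
  forall j, x' j = x j - g j / lambda j.

(* The scaling is positive and the step [x - (g_j / lambda_j)_j] maps E into E,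
   so that the method can be run on losses that are defined on E. *)
Definition admissible_scaling lambda : Prop :=
  (forall j, 0 < lambda j) /\
  (forall x g, (linf_norm g <= 1)%E -> exists x', gradient_step lambda x g x').

(* [xs i], [g i], [s i] are the iterate, subgradient and sample of round
   [i + 1]. *)
Definition gradient_method_run lambda d (S : measurableType d)
    (F : ell1 R -> S -> R) (k : nat) (s : nat -> S) (g : nat -> nat -> R)
    (xs : nat -> ell1 R) : Prop :=
  xs 0%N = 0 /\
  forall i, (i < k)%N ->
    subdifferential (F ^~ (s i)) (xs i) (g i) /\
    gradient_step lambda (xs i) (g i) (xs i.+1).

Definition average_regret d (S : measurableType d) (X : set (nat -> R))
    (F : ell1 R -> S -> R) (k : nat) (s : nat -> S) (xs : nat -> ell1 R)
    : \bar R :=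
  ereal_sup [set (k%:R^-1 * \sum_(i < k) (F (xs i) (s i) - F x (s i)))%:E
            | x in [set x : ell1 R | X x]].

Definition worst_case_regret (X : set (nat -> R)) lambda (k : nat) : \bar R :=
  ereal_sup [set v | exists d (S : measurableType d) (F : ell1 R -> S -> R)
      (s : nat -> S) (g : nat -> nat -> R) (xs : nat -> ell1 R),
    [/\ loss_class F, gradient_method_run lambda F k s g xs
      & v = average_regret X F k s xs]].

End stochastic_optimization.

(* Main.v *)
Require Import Defs.
From HB Require Import structures.
From mathcomp Require Import all_boot all_order all_algebra.
From mathcomp Require Import all_classical all_reals all_analysis.
From mathcomp Require Import measurable_realfun ring lra.

Set Implicit Arguments.
Unset Strict Implicit.
Unset Printing Implicit Defensive.

Import Order.TTheory GRing.Theory Num.Theory.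
Import numFieldNormedType.Exports.

Local Open Scope classical_set_scope.
Local Open Scope ring_scope.

(**
Write a_j for the weights and X for the weighted l_1 ball.

Nonlinear against linear estimation.  At noise level s a linear estimator A
does as badly on X, up to a constant, as on the ellipsoid of the x with
sum a_j^2 x_j^2 <= 1.  It suffices to look at the common vertices e_j / a_j and
- e_j / a_j: averaging the two risks removes the cross terms and leaves
s^2 sum_i A_ii^2 + (1 - A_jj)^2 / a_j^2, up to a constant.  Weighting the
vertices j < N by a_j^2, with N as large as sum_(j < N) a_j^2 <= s^-2 permits,
forces the risk N s^2 / 9 ([linear_risk_ge]); for a_j = j^(alpha/2) this is of
order s^(2 alpha / (1 + alpha)).  Soft thresholding instead uses that a point of
X has few large coordinates: keep the first m coordinates of y and threshold
the others at s j^(1/4).  Its risk is at most of order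
s^2 m + s m^(1/4 - alpha/2) ([threshold_estimator_risk]).  With
nu = s^(-2 / (1 + alpha)), N about nu and m about nu^(1 - 1/(2 alpha)), the
quotient of the two bounds is O(nu^(-1/(8 alpha))), which tends to 0
([rate_comparison]).  There is a power of s to spare, so the thresholds need not
be logarithmic and one moment of the noise replaces its exact tail.

Optimality of the gradient method.  With the scaling lambda_j = c a_j^2 the
regret splits into coordinates, and the bound for coordinate j adds up to
c/2 sum a_j^2 x_j^2 + k/(2c) sum a_j^-2.  The first sum is at most 1 on X and
the second one is finite exactly because alpha > 1, so c = sqrt k gives an
average regret of order 1 / sqrt k ([worst_case_regret_le]).  No rule does
better, already for the loss |x_1 - S| with a random sign S: k samples cannot
tell a sign of mean 1/(2 sqrt k) from one of mean -1/(2 sqrt k), and guessing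
the wrong one costs the mean ([minimax_stochastic_ge]).
*)

(** * Sequences and power sums *)

Section power_sums.
Context {R : realType}.

(** The partial sums S_n satisfy S_n <= S_(2n+1) <= 1 + 2^(1-p) S_n: for i >= 1 the
terms of ranks 2i and 2i+1 are at most 2^-p times the term of rank i.  The
inequality S_n <= 1 + 2^(1-p) S_n can then be solved for S_n. *)
Lemma sum_powRN_le (p : R) n : 1 < p ->
  \sum_(0 <= j < n) (j.+1%:R `^ p)^-1 <= (1 - 2 / 2 `^ p)^-1 :> R.
Proof.
move=> p1; set r := 2 / 2 `^ p; set u := fun j : nat => (j.+1%:R `^ p)^-1 : R.
have r1 : r < 1.
  rewrite ltr_pdivrMr ?powR_gt0// mul1r -[ltLHS]powRr1//.
  by rewrite /powR gt_eqF// ltr_expR ltr_pM2r ?ln_gt0 ?ltr1n.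
have u0 j : 0 <= u j by rewrite invr_ge0 powR_ge0.
have hlf i j : (i.+1.*2 <= j.+1)%N -> u j <= u i * (2 `^ p)^-1.
  move=> ij; rewrite /u -invfM -powRM// lef_pV2 ?posrE ?powR_gt0 ?mulr_gt0//.
  rewrite ge0_ler_powR ?nnegrE ?mulr_ge0//; first lra.
  by rewrite -natrM ler_nat muln2.
rewrite -[leRHS]mul1r ler_pdivlMr ?subr_gt0// mulrBr mulr1 lerBlDr.
have -> : (\sum_(0 <= j < n) u j) * r
    = \sum_(0 <= j < n) (u j * (2 `^ p)^-1 + u j * (2 `^ p)^-1).
  rewrite mulr_suml; apply: eq_bigr => j _; rewrite /r; lra.
apply: (@le_trans _ _ (\sum_(0 <= j < n.*2.+1) u j)).
  rewrite [leRHS](big_cat_nat (n := n))//= ?lerDl ?sumr_ge0//.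
  by rewrite -addnn -addnS leq_addr.
rewrite big_nat_recl// lerD//; first by rewrite /u powR1 invr1.
elim: n => [|n ih]; first by rewrite !big_nil.
rewrite doubleS !big_nat_recr//= -addrA lerD// lerD// hlf// ?doubleS//.
Qed.

End power_sums.

Section ell1_space.
Context {R : realType}.

Lemma linf_norm_ge (g : nat -> R) j : (`|g j|%:E <= linf_norm g)%E.
Proof. by apply: ereal_sup_ubound; exists j. Qed.

Lemma linf_norm_le (g : nat -> R) (c : R) :
  (linf_norm g <= c%:E)%E <-> forall j, `|g j| <= c.
Proof.
split=> [gc j|gc]; first by rewrite -lee_fin (le_trans (linf_norm_ge g j)).
by apply: ge_ereal_sup => _ [j _ <-]; rewrite lee_fin.
Qed.

Lemma ell1_summable (x : ell1 R) : summable [set: nat] (fun j => (x j)%:E).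
Proof. by case: x => x /= xl; move: xl; rewrite inE. Qed.

Lemma bounded_sums_summable (u : nat -> R) (B : R) :
  (forall n, \sum_(0 <= j < n) `|u j| <= B) ->
  summable [set: nat] (fun j => (u j)%:E).
Proof.
move=> uB; rewrite /summable -nneseries_esumT//.
apply: (@le_lt_trans _ _ B%:E); last by rewrite ltry.
apply: lime_le; first exact: is_cvg_nneseries.
apply: nearW => n; under eq_bigr do rewrite abse_EFin.
by rewrite sumEFin lee_fin.
Qed.

Lemma summable_bounded_sums (u : nat -> R) :
  summable [set: nat] (fun j => (u j)%:E) ->
  exists B : R, forall n, \sum_(0 <= j < n) `|u j| <= B.
Proof.
move=> su; have fs := su; rewrite summableE -nneseries_esumT// in fs.
exists (fine (\sum_(0 <= j <oo) `|(u j)%:E|)) => n.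
rewrite -lee_fin fineK// -sumEFin.
by apply: (@nneseries_lim_ge _ (fun j => `|(u j)%:E|%E) xpredT).
Qed.

Lemma ell1P (u : nat -> R) (B : R) :
  (forall n, \sum_(0 <= j < n) `|u j| <= B) -> exists x : ell1 R, x =1 u.
Proof.
move=> /bounded_sums_summable su.
have ul : (u : nat -> R^o) \in @in_ell1 R by rewrite inE.
by exists (Ell1 ul).
Qed.

Lemma cvg_sum_ord k (u : 'I_k -> nat -> R) (l : 'I_k -> R) :
  (forall i, u i n @[n --> \oo] --> l i) ->
  (\sum_(i < k) u i n) @[n --> \oo] --> \sum_(i < k) l i.
Proof.
move=> ul; elim: (index_enum _) => [|i s ih].
  by under eq_fun do rewrite big_nil; rewrite big_nil; exact: cvg_cst.
under eq_fun do rewrite big_cons; rewrite big_cons.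
by apply: (@cvgD _ R^o).
Qed.

(** [pairing] is a limit that is meaningful only when the series converges; here it
converges absolutely. *)
Lemma pairing_cvg (g : nat -> R) (x : ell1 R) : (linf_norm g < +oo)%E ->
  series (fun j => g j * x j) n @[n --> \oo] --> pairing g x.
Proof.
move=> gf; have [B xB] := summable_bounded_sums (ell1_summable x).
have g0 : (0 <= linf_norm g)%E by rewrite (le_trans _ (linf_norm_ge g 0%N)).
have gM : (linf_norm g <= (fine (linf_norm g))%:E)%E by rewrite fineK ?ge0_fin_numE.
move: gM => /linf_norm_le; set M := fine _ => gM.
have M0 : 0 <= M by rewrite fine_ge0.
suff : cvgn (series (fun j => g j * x j)) by [].
apply: normed_cvg; apply: nondecreasing_is_cvgn.
  by apply: nondecreasing_series => i _ _; exact: normr_ge0.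
exists (M * B) => _ [n _ <-] /=; rewrite /series/=.
apply: le_trans (ler_wpM2l M0 (xB n)); rewrite mulr_sumr.
by apply: ler_sum => j _; rewrite normrM ler_wpM2r.
Qed.

End ell1_space.

Section coordinate_vectors.
Context {R : realType}.

Definition basis_vec (j : nat) (v : R) (i : nat) : R := if i == j then v else 0.

Lemma sum_basis_vec (u : nat -> R) j v n :
  \sum_(0 <= i < n) u i * basis_vec j v i = if (j < n)%N then u j * v else 0.
Proof.
rewrite big_mkord; case: ifPn => jn.
  rewrite (bigD1 (Ordinal jn))//= {1}/basis_vec eqxx big1 ?addr0// => i.
  by rewrite -val_eqE /= /basis_vec => /negPf ->; rewrite mulr0.
rewrite big1// => i _; rewrite /basis_vec ifN ?mulr0//.
by apply: contra jn => /eqP <-.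
Qed.

Lemma ell1_basis_vec j v : exists x : ell1 R, x =1 basis_vec j v.
Proof.
apply: (@ell1P _ _ `|v|) => n.
under eq_bigr => i _.
  have -> : `|basis_vec j v i| = 1 * basis_vec j `|v| i.
    by rewrite mul1r /basis_vec; case: ifP; rewrite ?normr0.
  over.
by rewrite sum_basis_vec; case: ifP => // _; rewrite mul1r.
Qed.

Lemma pairing_basis_vec (g : nat -> R) (x : ell1 R) j v :
  x =1 basis_vec j v -> pairing g x = g j * v.
Proof.
move=> xE; apply: lim_near_cst => //; exists j.+1 => // n /= jn.
rewrite /series/= (eq_bigr (fun i => g i * basis_vec j v i)); last first.
  by move=> i _; rewrite xE.
by rewrite sum_basis_vec jn.
Qed.

Lemma pairing_basis_vecl (g : nat -> R) (x : ell1 R) j v :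
  g =1 basis_vec j v -> pairing g x = v * x j.
Proof.
move=> gE; apply: lim_near_cst => //; exists j.+1 => // n /= jn.
rewrite /series/= (eq_bigr (fun i => x i * basis_vec j v i)); last first.
  by move=> i _; rewrite gE mulrC.
by rewrite sum_basis_vec jn mulrC.
Qed.

Lemma weighted_l1_ball_basis_vec (a : nat -> R) j v : (forall i, 0 <= a i) ->
  `|v| * a j <= 1 -> weighted_l1_ball a (basis_vec j v).
Proof.
move=> a0 va; rewrite /weighted_l1_ball /=; apply: lime_le.
  by apply: is_cvg_nneseries => i _ _; rewrite lee_fin mulr_ge0.
apply: nearW => n; rewrite sumEFin lee_fin.
have -> : \sum_(0 <= i < n) a i * `|basis_vec j v i| =
    \sum_(0 <= i < n) a i * basis_vec j `|v| i.
  by apply: eq_bigr => i _; rewrite /basis_vec; case: ifP; rewrite ?normr0.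
by rewrite sum_basis_vec; case: ifP => // _; rewrite mulrC.
Qed.

End coordinate_vectors.

(** * Regret of the scaled gradient method *)

Section scaled_gradient_method.
Context {R : realType}.
Variables (a : nat -> R) (B : R).
Hypothesis (a1 : forall j, 1 <= a j).
Hypothesis (aB : forall n, \sum_(0 <= j < n) (a j ^+ 2)^-1 <= B).

Let a0 j : 0 < a j. Proof. exact: lt_le_trans (a1 j). Qed.

Lemma weighted_l1_ball_sum (x : nat -> R) n :
  weighted_l1_ball a x -> \sum_(0 <= j < n) a j * `|x j| <= 1.
Proof.
rewrite /weighted_l1_ball/= => xX; rewrite -lee_fin -sumEFin.
apply: le_trans xX; apply: (@nneseries_lim_ge _ _ xpredT) => j _ _.
by rewrite lee_fin mulr_ge0// ltW.
Qed.

Lemma weighted_l1_ball_sumsq (x : nat -> R) n :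
  weighted_l1_ball a x -> \sum_(0 <= j < n) a j ^+ 2 * x j ^+ 2 <= 1.
Proof.
move=> xX; apply: le_trans (weighted_l1_ball_sum n xX).
rewrite !big_seq; apply: ler_sum => j _.
have /= := weighted_l1_ball_sum j.+1 xX; rewrite big_nat_recr//= => h.
have {h} : a j * `|x j| <= 1.
  apply: le_trans h; rewrite lerDr sumr_ge0// => i _.
  by rewrite mulr_ge0// ltW.
have : 0 <= a j * `|x j| by rewrite mulr_ge0// ltW.
rewrite -exprMn -(real_normK (num_real (a j * x j))) normrM.
by rewrite (ger0_norm (ltW (a0 j))); nra.
Qed.

Lemma admissible_scaling_sq (c : R) : 0 < c ->
  admissible_scaling (fun j => c * a j ^+ 2).
Proof.
move=> c0; split=> [j|x g /linf_norm_le g1]; first by rewrite mulr_gt0// exprn_gt0.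
have [M xM] := summable_bounded_sums (ell1_summable x).
apply: (@ell1P _ (fun j => x j - g j / (c * a j ^+ 2)) (M + c^-1 * B)) => n.
apply: (@le_trans _ _
    (\sum_(0 <= j < n) `|x j| + c^-1 * \sum_(0 <= j < n) (a j ^+ 2)^-1)).
  rewrite mulr_sumr -big_split/=; apply: ler_sum => j _.
  rewrite (le_trans (ler_normB _ _))// lerD2l normrM normfV.
  rewrite (ger0_norm (mulr_ge0 (ltW c0) (sqr_ge0 _))) invfM.
  by rewrite ler_piMl// mulr_ge0// invr_ge0 ?sqr_ge0// (ltW c0).
by rewrite lerD// ler_wpM2l// invr_ge0 ltW.
Qed.

(** The gradient method in one coordinate.  The potential l/2 (x_i - z)^2 decreases
by g_i (x_i - z) at each step, up to the error g_i^2 / (2 l), and the sum over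
the steps telescopes. *)
Lemma gradient_step_telescope (l z : R) (x g : nat -> R) k : 0 < l ->
  x 0%N = 0 -> (forall i, (i < k)%N -> x i.+1 = x i - g i / l) ->
  (forall i, (i < k)%N -> `|g i| <= 1) ->
  \sum_(i < k) g i * (x i - z) <= l / 2 * z ^+ 2 + k%:R / 2 * l^-1.
Proof.
move=> l0 x0 xS g1.
have : \sum_(i < k) g i * (x i - z) <=
    l / 2 * z ^+ 2 - l / 2 * (x k - z) ^+ 2 + k%:R / 2 * l^-1.
  elim: k xS g1 => [|k ih] xS g1.
    by rewrite big_ord0 x0 sub0r sqrrN mul0r mul0r addr0 subrr.
  rewrite big_ord_recr/=.
  have {ih} := ih (fun i ik => xS i (leqW ik)) (fun i ik => g1 i (leqW ik)).
  have gk : g k ^+ 2 <= 1 by rewrite -real_normK ?num_real// expr_le1// g1.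
  rewrite (xS k)//.
  have -> : l / 2 * (x k - g k / l - z) ^+ 2 =
    l / 2 * (x k - z) ^+ 2 - g k * (x k - z) + g k ^+ 2 / 2 * l^-1.
    by field; rewrite gt_eqF.
  have : g k ^+ 2 / 2 * l^-1 <= 2^-1 * l^-1.
    by rewrite ler_wpM2r ?invr_ge0 ?(ltW l0)//; lra.
  by rewrite -[k.+1%:R]natr1; lra.
move=> /le_trans; apply; rewrite lerD2r gerBl.
by rewrite mulr_ge0 ?sqr_ge0// divr_ge0// ltW.
Qed.

(** The scaling is diagonal, so each coordinate can be treated on its own.  The
iterates are only known to lie in l_1, whence the detour through finitely many
coordinates and a limit instead of an argument with a weighted Euclidean norm. *)
Lemma worst_case_regret_le (c : R) k : 0 < c -> (0 < k)%N ->
  (worst_case_regret (weighted_l1_ball a) (fun j => c * a j ^+ 2)%R k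
    <= (k%:R^-1 * (c / 2 + k%:R / 2 * c^-1 * B))%R%:E)%E.
Proof.
move=> c0 k0; apply: ge_ereal_sup => _ [d [S [F [s [g [xs [FL [x0 run] ->]]]]]]].
apply: ge_ereal_sup => _ [x xX <-]; rewrite lee_fin ler_wpM2l//.
case: FL => _ _ _ Fg.
have g1 i : (i < k)%N -> (linf_norm (g i) <= 1)%E.
  by move=> /run[+ _]; exact: Fg.
have gf i : (i < k)%N -> (linf_norm (g i) < +oo)%E.
  by move=> /g1/le_lt_trans; apply; rewrite ltry.
have lin i : (i < k)%N ->
    F (xs i) (s i) - F x (s i) <= - pairing (g i) (x - xs i).
  by move=> /run[[_ /(_ x)] + _]; rewrite -lerBrDl; lra.
apply: (@le_trans _ _ (\sum_(i < k) - pairing (g i) (x - xs i))).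
  by apply: ler_sum => i _; exact: lin.
(* Sum over the rounds inside the limit, so as to bound it coordinatewise. *)
have cv : (\sum_(i < k) - series (fun j => g i j * (x - xs i) j) n)
     @[n --> \oo] --> \sum_(i < k) - pairing (g i) (x - xs i).
  apply: cvg_sum_ord => i; apply: (@cvgN _ R^o); exact: pairing_cvg (gf _ _).
rewrite -(cvg_lim (@norm_hausdorff _ _) cv).
apply: limr_le; first by apply: cvgP cv.
apply: nearW => n.
have -> : \sum_(i < k) - series (fun j => g i j * (x - xs i) j) n =
   \sum_(0 <= j < n) \sum_(i < k) g i j * (xs i j - x j).
  rewrite [RHS]exchange_big/=; apply: eq_bigr => i _.
  rewrite /series/= -sumrN; apply: eq_bigr => j _.
  by rewrite -mulrN opprB.
apply: (@le_trans _ _ (\sum_(0 <= j < n)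
   (c / 2 * (a j ^+ 2 * x j ^+ 2) + k%:R / 2 * c^-1 * (a j ^+ 2)^-1))).
  apply: ler_sum => j _.
  have l0 : 0 < c * a j ^+ 2 by rewrite mulr_gt0// exprn_gt0.
  have := @gradient_step_telescope _ (x j) (fun i => xs i j) (fun i => g i j) k l0.
  rewrite /= x0 => /(_ erefl) h.
  apply: le_trans (h _ _) _.
  - by move=> i /run[_ /(_ j)].
  - by move=> i /g1/linf_norm_le.
  - by rewrite invfM; lra.
rewrite big_split/= -!mulr_sumr lerD//.
  by rewrite ler_piMr ?divr_ge0 ?(ltW c0)// weighted_l1_ball_sumsq.
by rewrite ler_wpM2l// mulr_ge0 ?invr_ge0 ?divr_ge0 ?(ltW c0).
Qed.

End scaled_gradient_method.

(** * Testing between two biased coins *)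

Section testing.
Context {R : realType}.

(** A lower bound for the minimum by a combination of the geometric and the
arithmetic mean.  Summed over all samples, the products of square roots
factorize and the arithmetic means sum to a constant, which is not the case for
the minimum itself. *)
Lemma sqrt_sub_le (al be : R) : 0 <= al -> 0 <= be ->
  Num.sqrt (al * be) - (al + be) / 4 <= Num.min al be.
Proof.
move=> al0 be0; rewrite sqrtrM// le_min.
have key (u v : R) : u * v - (u ^+ 2 + v ^+ 2) / 4 <= u ^+ 2.
  by have := sqr_ge0 (v - 2 * u); have := sqr_ge0 u; lra.
have := key (Num.sqrt al) (Num.sqrt be); have := key (Num.sqrt be) (Num.sqrt al).
by rewrite !sqr_sqrtr// mulrC (addrC be) => -> ->.
Qed.

Lemma iid_samplesS (p : R) n (A : set (n.+1.-tuple bool)) : 0 <= p <= 1 ->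
  iid_samples (bernoulli_prob p : probability bool R) n.+1 A =
  (p%:E * iid_samples (bernoulli_prob p : probability bool R) n
             [set w | A (Defs.cons_tuple (true, w))]
   + (1 - p)%:E * iid_samples (bernoulli_prob p : probability bool R) n
             [set w | A (Defs.cons_tuple (false, w))])%E.
Proof.
move=> p01 /=; rewrite /pushforward/= /product_measure1.
rewrite integral_bernoulli_prob//.
rewrite /= /unstable.onem; congr (_ * _ + _ * _)%E; congr (iid_samples _ n _).
- by apply/seteqP; split=> w; rewrite /xsection /= inE.
- by apply/seteqP; split=> w; rewrite /xsection /= inE.
Qed.

Lemma measurable_cons_section n (A : set (n.+1.-tuple bool)) b :
  measurable A -> measurable [set w : n.-tuple bool | A (Defs.cons_tuple (b, w))].
Proof.
move=> mA; rewrite (_ : mkset _ = xsection (@Defs.cons_tuple _ bool n @^-1` A) b).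
  apply: measurable_xsection; rewrite -[X in measurable X]setTI.
  exact: measurable_cons_tuple.
by apply/seteqP; split=> w; rewrite /xsection /= inE.
Qed.

(** The sum of the square roots of the products of the probabilities of the two
coins, that is, one minus their squared Hellinger distance. *)
Definition affinity (p q : R) :=
  Num.sqrt (p * q) + Num.sqrt ((1 - p) * (1 - q)).

(** Le Cam's two-point bound for the sum of the two errors of a test.  Conditioning
on the first coin multiplies the prior weights [al] and [be] by the
probabilities of its outcome, so that the statement for general weights is
proved by induction on the number of coins, the affinity coming out once per
coin. *)
Lemma testing_bound (p q : R) k (A : set (k.-tuple bool)) (al be : R) :
  0 <= p <= 1 -> 0 <= q <= 1 -> 0 <= al -> 0 <= be -> measurable A ->
  ((Num.sqrt (al * be) * affinity p q ^+ k - (al + be) / 4)%:E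
   <= al%:E * iid_samples (bernoulli_prob p : probability bool R) k A
      + be%:E * iid_samples (bernoulli_prob q : probability bool R) k (~` A))%E.
Proof.
move=> p01 q01; elim: k A al be => [|k ih] A al be al0 be0 mA.
  rewrite /= !diracE expr0 mulr1.
  have := sqrt_sub_le al0 be0; rewrite le_min => /andP[h1 h2].
  have -> : ([tuple] \in ~` A) = ([tuple] \notin A) by rewrite in_setC.
  by case: (_ \in A) => /=; rewrite ?mule1 ?mule0 ?adde0 ?add0e lee_fin.
rewrite !iid_samplesS//.
have mAb b := measurable_cons_section b mA.
have p0 : 0 <= p by case/andP: p01.
have p1 : 0 <= 1 - p by rewrite subr_ge0; case/andP: p01.
have q0 : 0 <= q by case/andP: q01.
have q1 : 0 <= 1 - q by rewrite subr_ge0; case/andP: q01.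
have hT := ih _ (al * p) (be * q) (mulr_ge0 al0 p0) (mulr_ge0 be0 q0) (mAb true).
have hF := ih _ (al * (1 - p)) (be * (1 - q)) (mulr_ge0 al0 p1)
  (mulr_ge0 be0 q1) (mAb false).
apply: le_trans; last apply: le_trans (leeD hT hF) _.
  rewrite -EFinD lee_fin !(mulrACA al _ be) !(sqrtrM _ (mulr_ge0 al0 be0)).
  rewrite exprS {1}/affinity.
  move: (affinity p q ^+ k) (Num.sqrt _) (Num.sqrt _) (Num.sqrt _) => x y z t.
  by rewrite le_eqVlt; apply/orP; left; apply/eqP; field.
rewrite !muleDr// ?ge0_adde_def ?inE ?mule_ge0 ?lee_fin//.
by rewrite !EFinM -!muleA addeACA.
Qed.

End testing.

(** * A one-dimensional stochastic optimization problem *)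

Section hard_instance.
Context {R : realType}.

Definition coin_sign (b : bool) : R := if b then 1 else -1.
Definition first_coord (x : ell1 R) : R := x 0%N.
(** The mean distance to a random sign is least at 1 or at -1, hence at a point of
X, whereas a linear loss could be made arbitrarily
small by rules that leave X. *)
Definition abs_loss (x : ell1 R) (b : bool) : R := `|first_coord x - coin_sign b|.

Lemma first_coordD x y : first_coord (x + y) = first_coord x + first_coord y.
Proof. by []. Qed.

Lemma first_coordB x y : first_coord (x - y) = first_coord x - first_coord y.
Proof. by []. Qed.

Lemma first_coordZ c x : first_coord (c *: x) = c * first_coord x.
Proof. by []. Qed.

Lemma abs_loss_lip (x y : ell1 R) b :
  abs_loss (x + y) b - abs_loss x b <= `|first_coord y|.
Proof.
rewrite /abs_loss first_coordD lerBlDr; apply: le_trans (ler_normD _ _).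
by rewrite addrA (addrC (first_coord y)).
Qed.

(** Along the j-th basis vector the loss is 1-Lipschitz, which bounds coordinate j
of every subgradient. *)
Lemma loss_class_abs_loss : loss_class abs_loss.
Proof.
split=> [b t x y _ _|x|x b|x b g [_ gsub]].
- rewrite convRE /abs_loss (_ : first_coord _ - coin_sign b =
    t%:num * (first_coord x - coin_sign b)
    + (1 - t%:num) * (first_coord y - coin_sign b)).
    apply: le_trans (ler_normD _ _) _; rewrite !normrM /unstable.onem /=.
    by rewrite (ger0_norm (ge0 t)) (@ger0_norm _ (1 - _))// subr_ge0 le1.
  by rewrite first_coordD !first_coordZ /unstable.onem; ring.
- by [].
- pose s : R := if 0 <= first_coord x - coin_sign b then 1 else -1.
  exists (basis_vec 0 s); split.
    apply: (@le_lt_trans _ _ 1%:E); last by rewrite ltry.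
    apply/linf_norm_le => j; rewrite /basis_vec /s.
    by case: (j == 0%N); [case: (0 <= _)|]; rewrite ?normr0 ?normrN1 ?normr1.
  move=> y; rewrite (@pairing_basis_vecl R (basis_vec 0 s) (y - x) 0 s)// /abs_loss.
  rewrite -/(first_coord _) first_coordB.
  have h := ler_norm (first_coord y - coin_sign b).
  have := ler_norm (- (first_coord y - coin_sign b)).
  rewrite normrN /s; case: ifPn => [/ger0_norm ->|]; first lra.
  by rewrite -ltNge => /ltr0_norm ->; lra.
- apply/linf_norm_le => j.
  have key v : g j * v <= `|v|.
    have [e eE] := ell1_basis_vec j v.
    have := gsub (x + e); rewrite addrAC subrr add0r (pairing_basis_vec g eE).
    rewrite -lerBrDl => /le_trans; apply; apply: le_trans (abs_loss_lip _ _ _) _.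
    by rewrite /first_coord eE /basis_vec; case: ifP => // _; rewrite normr0.
  rewrite ler_norml; have := key 1; have := key (-1).
  by rewrite normrN1 normr1; lra.
Qed.

Definition tilted (e : R) : probability bool R := bernoulli_prob ((1 + e) / 2).

(** The expectation of |v - S| for a random sign S of mean [e]. *)
Definition tilted_loss (e v : R) : R :=
  (1 + e) / 2 * `|v - 1| + (1 - (1 + e) / 2) * `|v + 1|.

Lemma tilted01 (e : R) : `|e| <= 1 -> 0 <= (1 + e) / 2 <= 1.
Proof. by rewrite ler_norml => /andP[h1 h2]; apply/andP; split; lra. Qed.

Lemma population_loss_tilted e x : `|e| <= 1 ->
  population_loss (tilted e) abs_loss x = (tilted_loss e (first_coord x))%:E.
Proof.
move=> /tilted01 e1; rewrite /population_loss integral_bernoulli_prob//; last first.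
  by move=> b; rewrite lee_fin normr_ge0.
by rewrite /abs_loss /= opprK.
Qed.

Lemma tilted_loss_ge e v : `|e| <= 1 -> 1 - `|e| <= tilted_loss e v.
Proof.
rewrite ler_norml => /andP[e1 e2]; rewrite /tilted_loss.
have h1 := ler_norm (v - 1); have h2 := ler_norm (- (v - 1)).
have h3 := ler_norm (v + 1); have h4 := ler_norm (- (v + 1)).
rewrite !normrN in h2 h4.
move: `|v - 1| `|v + 1| h1 h2 h3 h4 => p q h1 h2 h3 h4.
case: (ger0P e) => e0; nra.
Qed.

(** Between -1 and 1 the loss is 1 - e v, so not having the sign of [e] costs at
least |e|; outside this interval the loss is larger still. *)
Lemma tilted_loss_wrong_sign e v : `|e| <= 1 -> e * v <= 0 ->
  `|e| <= tilted_loss e v - (1 - `|e|).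
Proof.
rewrite ler_norml => /andP[e1 e2] ev; rewrite /tilted_loss.
have h1 := ler_norm (v - 1); have h2 := ler_norm (- (v - 1)).
have h3 := ler_norm (v + 1); have h4 := ler_norm (- (v + 1)).
rewrite !normrN in h2 h4.
move: `|v - 1| `|v + 1| h1 h2 h3 h4 => p q h1 h2 h3 h4.
case: (ger0P e) => e0; nra.
Qed.

Lemma tilted_loss_opt e :
  tilted_loss e (if 0 <= e then 1 else -1) = 1 - `|e|.
Proof.
rewrite /tilted_loss; case: ifPn => [/ger0_norm ->|].
  by rewrite subrr normr0 ger0_norm//; lra.
rewrite -ltNge => /ltr0_norm ->.
by rewrite addNr normr0 ler0_norm; lra.
Qed.

Variable X : set (nat -> R).
Hypothesis Xe0 : forall v, `|v| <= 1 -> X (basis_vec 0 v).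

Lemma optimality_gap_tilted e x : `|e| <= 1 ->
  optimality_gap X (tilted e) abs_loss x =
  (tilted_loss e (first_coord x) - (1 - `|e|))%:E.
Proof.
move=> e1; rewrite /optimality_gap population_loss_tilted// EFinB; congr (_ - _)%E.
apply/eqP; rewrite eq_le; apply/andP; split; last first.
  apply: le_ereal_inf_tmp => _ [z _ <-].
  by rewrite population_loss_tilted// lee_fin tilted_loss_ge.
pose s : R := if 0 <= e then 1 else -1.
have [z zE] := ell1_basis_vec 0 s.
apply: ereal_inf_lbound; exists z.
  rewrite /= (funext zE : (z : nat -> R) = _); apply: Xe0.
  by rewrite /s; case: ifP; rewrite ?normrN normr1.
by rewrite population_loss_tilted// /first_coord zE tilted_loss_opt.
Qed.

(** The gap is nonnegative even at points outside X, so the expected loss is an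
integral of a nonnegative function and Markov's inequality applies. *)
Lemma excess_risk_tilted_ge k (h : k.-tuple (ell1 R -> R) -> ell1 R) (e : R)
    (A : set (k.-tuple bool)) :
  `|e| <= 1 -> @decision_rule R _ bool k h -> measurable A ->
  (forall w, A w ->
     e * first_coord (h [tuple of [seq (fun x => abs_loss x s) | s <- w]]) <= 0) ->
  (`|e|%:E * iid_samples (tilted e) k A
     <= excess_risk X h abs_loss (tilted e))%E.
Proof.
move=> e1 hdr mA Ae; rewrite /excess_risk /expected_loss.
pose v (w : k.-tuple bool) : R :=
  first_coord (h [tuple of [seq (fun x => abs_loss x s) | s <- w]]).
pose G w := (tilted_loss e (v w) - (1 - `|e|)).
have G0 w : 0 <= G w by rewrite subr_ge0 tilted_loss_ge.
have mv : measurable_fun setT v := hdr _ loss_class_abs_loss 0%N.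
have mG : measurable_fun setT G.
  apply: measurable_funB => //; apply: measurable_funD; apply: measurable_funM => //.
    by apply: measurableT_comp => //; exact: measurable_funB.
  by apply: measurableT_comp => //; exact: measurable_funD.
rewrite (_ : (fun w => optimality_gap _ _ _ _) = (fun w => (G w)%:E)); last first.
  by apply/funext => w; rewrite optimality_gap_tilted.
rewrite (eq_integral (fun w => (G w)%:E)); last first.
  by move=> w _; rewrite (@ge0_funeposE _ _ setT) ?inE// => u _; rewrite lee_fin.
rewrite [X in (_ - X)%dE](eq_integral (cst 0%E)); last first.
  by move=> w _; rewrite (@ge0_funenegE _ _ setT) ?inE// => u _; rewrite lee_fin.
rewrite integral0 oppe0 addr0.
rewrite -[A in (_ * _ A)%E]setIT -integral_indic// -ge0_integralZl_EFin//; last first.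
  exact/measurable_EFinP/measurable_indic.
apply: ge0_le_integral => //.
- by apply/measurable_EFinP/measurable_funM => //; exact: measurable_indic.
- exact/measurable_EFinP.
move=> w _; rewrite -EFinM lee_fin indicE.
have [Aw|_] := boolP (w \in A); last by rewrite mulr0.
by rewrite mulr1 tilted_loss_wrong_sign//; apply: Ae; rewrite inE in Aw.
Qed.

Lemma bernoulli_ineq (x : R) n : 0 <= x <= 1 -> 1 - n%:R * x <= (1 - x) ^+ n.
Proof.
move=> /andP[x0 x1]; elim: n => [|n ih]; first by rewrite mul0r subr0 expr0.
have : (1 - n%:R * x) * (1 - x) <= (1 - x) ^+ n * (1 - x).
  by rewrite ler_wpM2r ?subr_ge0.
rewrite -exprSr -natr1 => /(le_trans _); apply.
have : 0 <= n%:R * (x * x) by rewrite !mulr_ge0.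
lra.
Qed.

(** The coins of mean e and -e, for e = 1 / (2 sqrt k), have squared affinity
1 - e^2, hence affinity at least 3/4 over k tosses.  One of the two signs is
then guessed wrongly with probability at least 1/8, at the cost e. *)
Lemma minimax_stochastic_ge k : (0 < k)%N ->
  ((16 * Num.sqrt k%:R)^-1%:E <= minimax_stochastic X k)%E.
Proof.
move=> k0; have k0R : 0 < Num.sqrt k%:R :> R by rewrite sqrtr_gt0 ltr0n.
have k1R : 1 <= Num.sqrt k%:R :> R by rewrite -[leLHS]sqrtr1 ler_wsqrtr// ler1n.
pose e : R := (2 * Num.sqrt k%:R)^-1.
have e0 : 0 < e by rewrite invr_gt0 mulr_gt0.
have e1 : e <= 1 by rewrite invf_le1 ?mulr_gt0//; lra.
have ke : k%:R * e ^+ 2 = 4^-1.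
  rewrite /e exprVn exprMn sqr_sqrtr// invfM mulrCA divff ?mulr1 ?pnatr_eq0 -?lt0n//.
  by rewrite -natrX.
apply: (@le_trans _ _ (minimax_excess_on bool X k)); last first.
  by apply: ereal_sup_ubound; exists _, bool.
apply: le_ereal_inf_tmp => _ [h hdr <-].
set M := ereal_sup _.
have risk_le e' : `|e'| <= 1 -> (excess_risk X h abs_loss (tilted e') <= M)%E.
  move=> e'1; apply: (@le_trans _ _
    (ereal_sup [set excess_risk X h abs_loss P | P in integrable_losses abs_loss])).
    apply: ereal_sup_ubound; exists (tilted e') => // x.
    apply/integrableP; split; first exact/measurable_EFinP.
    rewrite integral_bernoulli_prob//; last exact: tilted01.
    by rewrite -!EFinM -EFinD ltry.
  by apply: ereal_sup_ubound; exists abs_loss => //; exact: loss_class_abs_loss.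
pose A := [set w : k.-tuple bool |
  first_coord (h [tuple of [seq (fun x => abs_loss x s) | s <- w]]) <= 0].
have mA : measurable A.
  have := hdr _ loss_class_abs_loss 0%N measurableT _ (measurable_itv `]-oo, (0 : R)]).
  by rewrite setTI.
have ea : `|e| <= 1 by rewrite (gtr0_norm e0).
have ea' : `|- e| <= 1 by rewrite normrN.
have hp : (e%:E * iid_samples (tilted e) k A <= M)%E.
  apply: le_trans (risk_le e ea); rewrite -{1}(gtr0_norm e0).
  apply: excess_risk_tilted_ge => //.
  by move=> w Aw; rewrite pmulr_rle0.
have hm : (e%:E * iid_samples (tilted (- e)) k (~` A) <= M)%E.
  apply: le_trans (risk_le (- e) ea'); rewrite -{1}(gtr0_norm e0) -normrN.
  apply: excess_risk_tilted_ge => //.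
  - exact: measurableC.
  move=> w; rewrite /A /= => /negP; rewrite -ltNge => /ltW h0.
  by rewrite mulNr oppr_le0 mulr_ge0// ltW.
have h2 := testing_bound (tilted01 ea) (tilted01 ea') ler01 ler01 mA.
have aff2 : affinity ((1 + e) / 2) ((1 + - e) / 2) ^+ 2 = 1 - e ^+ 2.
  rewrite /affinity (_ : (1 - (1 + e) / 2) * _ = (1 + e) / 2 * ((1 + - e) / 2)).
    2: by field.
  rewrite -mulr2n exprMn_n sqr_sqrtr; last by rewrite mulr_ge0//; lra.
  by rewrite -mulr_natr; field.
have affk : 1 / 4 <= Num.sqrt (1 * 1) *
    affinity ((1 + e) / 2) ((1 + - e) / 2) ^+ k - (1 + 1) / 4.
  have e21 : 0 <= e ^+ 2 <= 1 by rewrite sqr_ge0 expr_le1//= ltW.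
  have := bernoulli_ineq k e21; rewrite ke -aff2.
  have aff0 : 0 <= affinity ((1 + e) / 2) ((1 + - e) / 2).
    by rewrite addr_ge0// sqrtr_ge0.
  have aff1 : affinity ((1 + e) / 2) ((1 + - e) / 2) <= 1.
    by rewrite -(@expr_le1 _ 2)// aff2; lra.
  rewrite mulr1 sqrtr1 mul1r => h3.
  suff : (affinity ((1 + e) / 2) ((1 + - e) / 2) ^+ 2) ^+ k <=
     affinity ((1 + e) / 2) ((1 + - e) / 2) ^+ k by lra.
  by rewrite lerXn2r ?nnegrE ?sqr_ge0// expr2 ler_piMr.
rewrite !mul1e in h2.
have : ((e / 4)%:E <= M + M)%E.
  apply: le_trans (leeD hp hm).
  rewrite -muleDr// ?ge0_adde_def ?inE//.
  rewrite EFinM lee_wpmul2l ?lee_fin ?(ltW e0)//.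
  by apply: le_trans h2; rewrite lee_fin; lra.
have -> : (16 * Num.sqrt k%:R)^-1 = e / 8.
  by rewrite /e; field; rewrite gt_eqF.
by case: M {hp hm risk_le} => [r| |]; rewrite ?leey// -?EFinD ?lee_fin ?leeNy_eq//; lra.
Qed.

End hard_instance.

(** * Gaussian moments *)

Section gaussian.
Context {R : realType}.
Local Notation leb := (@lebesgue_measure R).

(** The density agrees almost everywhere with the Radon-Nikodym derivative, for
which the change of variables is known. *)
Lemma ge0_integral_normal_prob (m s : R) (f : R -> \bar R) :
  measurable_fun setT f -> (forall x, 0 <= f x)%E ->
  (\int[normal_prob m s]_x f x = \int[leb]_x (f x * (normal_pdf m s x)%:E))%E.
Proof.
move=> mf f0; have dom := normal_prob_dominates m s.
rewrite -(Radon_Nikodym_SigmaFinite.change_of_variables dom)//.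
have mpdf : measurable_fun setT (fun x => (normal_pdf m s x)%:E).
  by apply/measurable_EFinP; exact: measurable_normal_pdf.
have iRN := Radon_Nikodym_SigmaFinite.f_integrable dom.
apply: ae_eq_integral => //.
- by apply: emeasurable_funM => //; exact: measurable_int iRN.
- exact: emeasurable_funM.
apply: ae_eqe_mul2l; apply: integral_ae_eq => // E _ mE.
by rewrite -Radon_Nikodym_SigmaFinite.f_integral.
Qed.

Lemma expR_ge_monomial (n : nat) (x : R) : 0 <= x -> x ^+ n <= n`!%:R * expR x.
Proof.
move=> x0; case: n => [|n].
  by rewrite expr0 mul1r -[leLHS]expR0 ler_expR.
rewrite mulrC -ler_pdivrMr ?ltr0n ?fact_gt0//.
by apply: le_trans (expR_ge1Dxn n x0); rewrite lerDr.
Qed.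

(** With u = x^2 / (4 s^2) the densities are proportional to exp(-2 u) and
exp(-u/2), and u^n <= n! exp u.  Integrating bounds the moments without
computing them. *)
Lemma normal_pdf_wider (s x : R) n : 0 < s ->
  x ^+ n.*2 * normal_pdf 0 s x <=
  2 * n`!%:R * (4 * s ^+ 2) ^+ n * normal_pdf 0 (2 * s) x.
Proof.
move=> s0; have s20 : 0 < 2 * s by rewrite mulr_gt0.
rewrite !normal_pdfE ?gt_eqF// /normal_fun !subr0.
have -> : normal_peak s = 2 * normal_peak (2 * s).
  have sc (p : R) : (2 * s) ^+ 2 * p *+ 2 = 2 ^+ 2 * (s ^+ 2 * p *+ 2).
    by rewrite exprMn -mulrA -mulrnAr.
  rewrite /normal_peak sc sqrtrM ?sqr_ge0//.
  by rewrite sqrtr_sqr ger0_norm// invfM mulrA divff// mul1r.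
pose u := x ^+ 2 / (4 * s ^+ 2).
have u0 : 0 <= u by rewrite divr_ge0 ?sqr_ge0// mulr_ge0 ?sqr_ge0.
have xu : x ^+ n.*2 = (4 * s ^+ 2) ^+ n * u ^+ n.
  rewrite -exprMn mulrC divfK -?exprM ?mul2n//.
  by rewrite gt_eqF// mulr_gt0// exprn_gt0.
have -> : - x ^+ 2 / (s ^+ 2 *+ 2) = - (2 * u).
  by rewrite /u -mulr_natr; field; rewrite gt_eqF.
have -> : - x ^+ 2 / ((2 * s) ^+ 2 *+ 2) = - (u / 2).
  by rewrite /u -mulr_natr; field; rewrite gt_eqF.
rewrite xu.
have key : u ^+ n * expR (- (2 * u)) <= n`!%:R * expR (- (u / 2)).
  apply: (@le_trans _ _ (n`!%:R * expR u * expR (- (2 * u)))).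
    by rewrite ler_wpM2r ?expR_ge0// expR_ge_monomial.
  by rewrite -mulrA -expRD ler_wpM2l// ler_expR; lra.
have c0 : 0 <= (4 * s ^+ 2) ^+ n * (2 * normal_peak (2 * s)).
  apply: mulr_ge0; first by rewrite exprn_ge0// mulr_ge0 ?sqr_ge0.
  by rewrite mulr_ge0 ?normal_peak_ge0.
have := ler_wpM2l c0 key.
move: (normal_peak _) (expR _) (expR _) (u ^+ n) ((4 * s ^+ 2) ^+ n) n`!%:R.
by move=> p e1 e2 v c f; lra.
Qed.

Lemma gaussian_even_moment_le (s : R) n : 0 < s ->
  (\int[normal_prob 0 s]_x (x ^+ n.*2)%:E <= (2 * n`!%:R * (4 * s ^+ 2) ^+ n)%R%:E)%E.
Proof.
move=> s0; have ev (x : R) : 0 <= x ^+ n.*2 by rewrite -mul2n exprM exprn_ge0// sqr_ge0.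
have c0 : 0 <= 2 * n`!%:R * (4 * s ^+ 2) ^+ n.
  by rewrite !mulr_ge0// exprn_ge0// mulr_ge0 ?sqr_ge0.
rewrite ge0_integral_normal_prob//; last first.
  by apply/measurable_EFinP; exact: exprn_measurable.
apply: (@le_trans _ _ (\int[leb]_x ((2 * n`!%:R * (4 * s ^+ 2) ^+ n)%R%:E *
    (normal_pdf 0 (2 * s) x)%:E))%E).
  apply: ge0_le_integral => //.
  - move=> x _; rewrite -EFinM lee_fin mulr_ge0 ?normal_pdf_ge0//.
  - apply: emeasurable_funM; apply/measurable_EFinP; first exact: exprn_measurable.
    exact: measurable_normal_pdf.
  - apply: emeasurable_funM => //; apply/measurable_EFinP.
    exact: measurable_normal_pdf.
  - by move=> x _; rewrite -!EFinM lee_fin normal_pdf_wider.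
rewrite ge0_integralZl_EFin//.
- by rewrite integral_normal_pdf mule1.
- by move=> x _; rewrite lee_fin normal_pdf_ge0.
- by apply/measurable_EFinP; exact: measurable_normal_pdf.
Qed.

(** The density is at most 1 / (s sqrt (2 pi)), hence at most 1 / (2 s). *)
Lemma gaussian_interval_le (s : R) : 0 < s ->
  (normal_prob 0 s `[(- (s / 2))%R, (s / 2)%R]%classic <= (2^-1)%:E)%E.
Proof.
move=> s0; rewrite /normal_prob.
apply: (@le_trans _ _
    (\int[leb]_(x in `[(- (s / 2))%R, (s / 2)%R]) cst (normal_peak s)%:E x)%E).
  apply: ge0_le_integral => //.
  - by move=> x _; rewrite lee_fin normal_pdf_ge0.
  - apply: measurable_funTS; apply/measurable_EFinP; exact: measurable_normal_pdf.
  - by move=> x _; rewrite lee_fin normal_pdf_ub// gt_eqF.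
rewrite integral_cst//= lebesgue_measure_itv/= lte_fin ifT; last lra.
rewrite -EFinD -EFinM lee_fin opprK -splitr /normal_peak.
rewrite mulrC ler_pdivrMr; last first.
  by rewrite sqrtr_gt0 mulrn_wgt0// mulr_gt0 ?exprn_gt0 ?pi_gt0.
rewrite -ler_pdivrMl// invrK -[leLHS](ger0_norm (x := 2 * s)); last lra.
rewrite -sqrtr_sqr ler_wsqrtr// exprMn -mulr_natr.
have := pi_ge2 R; have : 0 < s ^+ 2 by rewrite exprn_gt0.
move: (s ^+ 2) pi => t p t0 p2; nra.
Qed.

(** Half of the mass lies outside [- s/2, s/2]. *)
Lemma gaussian_second_moment_ge (s : R) : 0 < s ->
  ((s ^+ 2 / 8)%:E <= \int[normal_prob 0 s]_x (x ^+ 2)%:E)%E.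
Proof.
move=> s0; pose I := `[(- (s / 2))%R, (s / 2)%R]%classic : set R.
have mI : measurable I by exact: measurable_itv.
have PI := gaussian_interval_le s0.
have PC : ((2^-1)%:E <= normal_prob 0 s (~` I))%E.
  rewrite probability_setC// -/I.
  apply: (@le_trans _ _ (1 - (2^-1)%:E)%E); last exact: leeB.
  by rewrite -EFinB lee_fin; lra.
apply: (@le_trans _ _ (\int[normal_prob 0 s]_x ((s ^+ 2 / 4)%:E * (\1_(~` I) x)%:E))%E).
  rewrite ge0_integralZl_EFin//; last 2 first.
  - apply/measurable_EFinP; apply: measurable_indic; exact: measurableC.
  - by rewrite divr_ge0 ?sqr_ge0.
  rewrite integral_indic ?setIT//; last exact: measurableC.
  have -> : s ^+ 2 / 8 = s ^+ 2 / 4 * 2^-1 by field.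
  by rewrite EFinM lee_wpmul2l// lee_fin divr_ge0 ?sqr_ge0.
apply: ge0_le_integral => //.
- move=> x _; rewrite -EFinM lee_fin mulr_ge0 ?divr_ge0 ?sqr_ge0//.
- apply: emeasurable_funM => //; apply/measurable_EFinP.
  by apply: measurable_indic; exact: measurableC.
- by apply/measurable_EFinP; exact: exprn_measurable.
move=> x _; rewrite -EFinM lee_fin indicE in_setC.
have [xI|xI] := boolP (x \in I); first by rewrite mulr0 sqr_ge0.
rewrite mulr1; rewrite notin_setE /I /= in_itv /= in xI.
move/negP: xI; rewrite negb_and -!ltNge => /orP[h|h].
  have : 0 <= (- x - s / 2) * (- x + s / 2) by rewrite mulr_ge0//; lra.
  nra.
have : 0 <= (x - s / 2) * (x + s / 2) by rewrite mulr_ge0//; lra.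
nra.
Qed.

End gaussian.

(** * The law of a Gaussian sequence *)

Section sequence_space.
Context {R : realType}.

Lemma normal_prob_opp (s : R) (A : set R) : s != 0 -> measurable A ->
  normal_prob 0 s (-%R @^-1` A) = normal_prob 0 s A.
Proof.
move=> s0 mA; rewrite /normal_prob.
have mpdf : measurable_fun setT (fun x => (normal_pdf 0 s x)%:E).
  by apply/measurable_EFinP; exact: measurable_normal_pdf.
transitivity (\int[pushforward lebesgue_measure (-%R : _ -> measurableTypeR R)]_(x in A)
    (normal_pdf 0 s x)%:E)%E; last first.
  by apply: eq_measure_integral => //= B mB _; exact: lebesgue_measureN.
rewrite ge0_integral_pushforward//=; last 2 first.
- exact: measurable_funTS.
- by move=> x _; rewrite lee_fin normal_pdf_ge0.
apply: eq_integral => x _ /=.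
by rewrite !normal_pdfE// /normal_fun !subr0 sqrrN.
Qed.

Definition box n (B : nat -> set R) : set (seqspace R) :=
  [set y | forall j, (j < n)%N -> B j (y j)].

Definition boxes : set (set (seqspace R)) :=
  [set A | exists n B, (forall j, measurable (B j)) /\ A = box n B].

(** The codomain is the copy of R on which [normal_prob] is a measure. *)
Definition noise_coord j (y : seqspace R) : measurableTypeR R := y j.

Lemma measurable_noise_coord j : measurable_fun [set: seqspace R] (noise_coord j).
Proof.
move=> _ B mB; rewrite setTI; apply: sub_sigma_algebra; exists j => //.
by exists B => //; rewrite setTI.
Qed.

HB.instance Definition _ j :=
  isMeasurableFun.Build _ _ _ _ (noise_coord j) (measurable_noise_coord j).

Lemma measurable_seqspaceP d (T : measurableType d) (f : T -> seqspace R) :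
  (forall j, measurable_fun setT (fun t => f t j : R)) -> measurable_fun setT f.
Proof.
move=> mf; apply: (@measurability _ _ T (seqspace R) setT f (@cylinders R)) => //.
move=> _ [_ [j _ [B mB <-]] <-].
by rewrite !setTI; have := mf j measurableT _ mB; rewrite setTI; exact.
Qed.

Lemma measurable_box n B : (forall j, measurable (B j)) ->
  measurable (box n B).
Proof.
move=> mB; rewrite (_ : box n B =
   \bigcap_(j in `I_n) (noise_coord j @^-1` B j)); last first.
  by [].
apply: bigcap_measurableType => // j _.
by have := measurable_noise_coord j measurableT (mB j); rewrite setTI.
Qed.

Lemma measurable_boxes : @measurable _ (seqspace R) = <<s boxes >>.
Proof.
apply/seteqP; split.
- apply: smallest_sub; first exact: smallest_sigma_algebra.
  move=> _ [j _ [B mB <-]]; rewrite setTI; apply: sub_sigma_algebra.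
  exists j.+1, (fun i => if i == j then B else setT); split=> [i|].
    by case: ifP.
  apply/seteqP; split=> y /=.
    by move=> By i _; case: eqP => // ->.
  by move=> /(_ j (ltnSn j)); rewrite eqxx.
- apply: smallest_sub; first exact: sigma_algebra_measurable.
  by move=> _ [n [B [mB ->]]]; exact: measurable_box.
Qed.

Lemma setI_closed_boxes : setI_closed boxes.
Proof.
move=> _ _ [n [B [mB ->]]] [m [C [mC ->]]].
exists (maxn n m), (fun j => (if (j < n)%N then B j else setT) `&`
                   (if (j < m)%N then C j else setT)); split=> [j|].
  by apply: measurableI; case: ifP.
apply/seteqP; split=> y.
  by move=> [yB yC] j _; split; case: ifP => // h; [exact: yB|exact: yC].
move=> yBC; split=> j jn.
  have /yBC[] : (j < maxn n m)%N by rewrite leq_max jn.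
  by rewrite jn.
have /yBC[] : (j < maxn n m)%N by rewrite leq_max jn orbT.
by rewrite jn.
Qed.

(** Boxes are stable under intersection and generate the sigma-algebra. *)
Lemma eq_seqspace_prob (mu nu : probability (seqspace R) R) :
  (forall n B, (forall j, measurable (B j)) ->
     mu (box n B) = nu (box n B)) ->
  forall A, measurable A -> mu A = nu A.
Proof.
move=> eqc A mA.
apply: (measure_unique boxes (fun=> setT)) => //.
- exact: measurable_boxes.
- exact: setI_closed_boxes.
- by move=> _; exists 0%N, (fun=> setT); split => //; apply/seteqP; split.
- by apply/seteqP; split => // y _; exists 0%N.
- by move=> _ [n [B [mB ->]]]; exact: eqc.
- by move=> k /=; rewrite probability_setT ltry.
Qed.

Definition flip_coord i (y : seqspace R) : seqspace R :=
  fun j => if j == i then - y j else y j.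

Lemma measurable_flip_coord i : measurable_fun [set: seqspace R] (flip_coord i).
Proof.
apply: measurable_seqspaceP => j; rewrite /flip_coord; case: (j == i).
  by apply: measurableT_comp => //; exact: measurable_noise_coord.
exact: measurable_noise_coord.
Qed.

HB.instance Definition _ i :=
  isMeasurableFun.Build _ _ _ _ (flip_coord i) (measurable_flip_coord i).

Variables (s : R) (s0 : s != 0) (mu : probability (seqspace R) R).
Hypothesis gmu : iid_gaussian s mu.

Lemma iid_gaussian_marginal j B : measurable B ->
  mu [set y | B (y j)] = normal_prob 0 s B.
Proof.
move=> mB; pose C i := if i == j then B else setT.
have mC i : measurable (C i) by rewrite /C; case: ifP.
transitivity (mu [set y : seqspace R | forall i, (i < j.+1)%N -> C i (y i)]).
  congr (mu _); apply/seteqP; split=> y /=.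
    by move=> By i _; rewrite /C; case: eqP => // ->.
  by move=> /(_ j (ltnSn j)); rewrite /C eqxx.
rewrite gmu// big_ord_recr/= {2}/C eqxx big1 ?mul1e// => i _.
by rewrite /C ltn_eqF ?probability_setT.
Qed.

Lemma ge0_integral_noise_coord j (f : R -> \bar R) : measurable_fun setT f ->
  (forall x, 0 <= f x)%E ->
  (\int[mu]_y f (y j) = \int[normal_prob 0 s]_x f x)%E.
Proof.
move=> mf f0.
transitivity (\int[distribution mu (noise_coord j)]_x f x)%E.
  by rewrite ge0_integral_pushforward.
apply: eq_measure_integral => A mA _; exact: iid_gaussian_marginal.
Qed.

(** The reflection in one coordinate preserves boxes and, N(0, s^2) being
symmetric, their probabilities. *)
Lemma ge0_integral_flip_coord i (f : seqspace R -> \bar R) : measurable_fun setT f ->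
  (forall x, 0 <= f x)%E ->
  (\int[mu]_y f (flip_coord i y) = \int[mu]_y f y)%E.
Proof.
move=> mf f0; transitivity (\int[distribution mu (flip_coord i)]_x f x)%E.
  by rewrite ge0_integral_pushforward.
apply: eq_measure_integral => A mA _; apply: eq_seqspace_prob => // n B mB.
pose C j := if j == i then -%R @^-1` B j else B j.
have mN : measurable (-%R @^-1` B i).
  by rewrite -[X in measurable X]setTI; exact: oppr_measurable.
have mC j : measurable (C j) by rewrite /C; case: eqP => // ->.
transitivity (mu (box n C)).
  congr (mu _); apply/seteqP; split=> y yB j jn; have /= := yB j jn;
    by rewrite /flip_coord /C; case: ifP.
rewrite !gmu//; apply: eq_bigr => j _; rewrite /C.
by case: ifP => // _; rewrite normal_prob_opp.
Qed.

End sequence_space.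

(** * Linear estimators *)

Section linear_lower_bound.
Context {R : realType}.
Variables (s : R) (s0 : 0 < s) (mu : probability (seqspace R) R).
Hypothesis gmu : iid_gaussian s mu.
Variable A : seqspace R -> seqspace R.
Hypothesis linA : linear_estimator A.

Definition diagonal_entry i : R := A (basis_vec i 1) i.

Lemma linear_estimator_coord i : measurable_fun [set: seqspace R] (fun y => A y i : R).
Proof.
by apply: (measurableT_comp (measurable_noise_coord i)); case: linA.
Qed.

Lemma linear_estimator_shift j b y i :
  A (fun l => basis_vec j b l + y l) i = b * A (basis_vec j 1) i + A y i.
Proof.
case: linA => _ /(_ b (basis_vec j 1) y) /(congr1 (fun f => f i)) <-.
congr (A _ i); apply/funext => l; congr (_ + _).
by rewrite /basis_vec; case: ifP => _; rewrite ?mulr1 ?mulr0.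
Qed.

(** Coordinate i of A y is A_ii y_i plus a term that does not depend on y_i.
Averaging over the sign of y_i, the square of the sum is at least
A_ii^2 y_i^2. *)
Lemma diagonal_entry_moment i :
  ((diagonal_entry i ^+ 2 * (s ^+ 2 / 8))%:E <= \int[mu]_y ((A y i) ^+ 2)%:E)%E.
Proof.
set c := diagonal_entry i.
have mA := linear_estimator_coord i.
have mA2 : measurable_fun setT (fun y => ((A y i) ^+ 2)%:E).
  by apply/measurable_EFinP; exact: measurable_funX.
have my2 : measurable_fun [set: seqspace R] (fun y => ((y i : R) ^+ 2)%:E).
  by apply/measurable_EFinP; apply: measurable_funX; exact: measurable_noise_coord.
have flipE y : A (flip_coord i y) i = A y i - 2 * y i * c.
  rewrite /c /diagonal_entry addrC -mulNr -linear_estimator_shift.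
  congr (A _ i); apply/funext => l; rewrite /flip_coord /basis_vec.
  by case: eqP => [->|_]; rewrite ?add0r//; ring.
have sE := ge0_integral_flip_coord (lt0r_neq0 s0) gmu i mA2.
have {sE} sE := sE (fun y => sqr_ge0 _).
have mF : measurable_fun setT (fun y => ((A (flip_coord i y) i) ^+ 2)%:E).
  apply/measurable_EFinP; apply: measurable_funX.
  exact: (measurableT_comp mA (measurable_flip_coord i)).
(* z^2 + (z - 2 v c)^2 = 2 (z - v c)^2 + 2 v^2 c^2, for z = A y i and v = y i. *)
have : ((2 * c ^+ 2)%:E * \int[mu]_y ((y i : R) ^+ 2)%:E <=
    \int[mu]_y ((A y i) ^+ 2)%:E + \int[mu]_y ((A y i) ^+ 2)%:E)%E.
  rewrite -{2}sE -ge0_integralD//; last 2 first.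
    by move=> y _; rewrite lee_fin sqr_ge0.
    by move=> y _; rewrite lee_fin sqr_ge0.
  rewrite -ge0_integralZl_EFin//; last 2 first.
    by move=> y _; rewrite lee_fin sqr_ge0.
    by rewrite mulr_ge0 ?sqr_ge0.
  apply: ge0_le_integral => //.
  - move=> y _; rewrite -EFinM lee_fin; apply: mulr_ge0 (sqr_ge0 _).
    exact: mulr_ge0 (sqr_ge0 _).
  - exact: emeasurable_funM.
  - exact: emeasurable_funD.
  - move=> y _; rewrite -EFinM -EFinD lee_fin flipE.
    move: (A y i) (y i) => z v; have := sqr_ge0 (z - v * c); lra.
rewrite (ge0_integral_noise_coord gmu i (f := fun x => (x ^+ 2)%:E)); last 2 first.
- by apply/measurable_EFinP; exact: exprn_measurable.
- by move=> x; rewrite lee_fin sqr_ge0.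
move=> h.
have := le_trans (lee_wpmul2l _ (gaussian_second_moment_ge s0)) h.
rewrite lee_fin => /(_ (mulr_ge0 (ler0n _ _) (sqr_ge0 _))).
case: (\int[mu]_y _)%E => [r| |]; rewrite ?leey//.
by rewrite -EFinM -EFinD !lee_fin; lra.
Qed.

(** By the parallelogram law, the errors A y + b (A e_j - e_j) and
A y - b (A e_j - e_j) have squares that sum to twice the sum of the squares of
the two parts, whatever the correlation between them. *)
Lemma square_risk_two_vertices (b : R) (j N : nat) : (j < N)%N ->
  ((2 * (\sum_(i < N) diagonal_entry i ^+ 2 * (s ^+ 2 / 8)
     + b ^+ 2 * (1 - diagonal_entry j) ^+ 2))%:E
   <= square_risk mu A (basis_vec j b) + square_risk mu A (basis_vec j (- b)))%E.
Proof.
move=> jN; pose x (v : R) := basis_vec j v.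
pose e i (v : R) (y : seqspace R) := ((A (fun l => x v l + y l) i - x v i) ^+ 2).
have e0 i v y : 0 <= e i v y by exact: sqr_ge0.
pose d i : R := A (basis_vec j 1) i - basis_vec j 1 i.
have eE i v y : e i v y = (A y i + v * d i) ^+ 2.
  rewrite /e linear_estimator_shift /d /x; congr (_ ^+ 2).
  by rewrite /basis_vec; case: ifP => _; ring.
have mAi := linear_estimator_coord.
have me i v : measurable_fun setT (fun y => (e i v y)%:E).
  rewrite (_ : (fun y => _) = (fun y => ((A y i + v * d i) ^+ 2)%:E)).
    apply/measurable_EFinP; apply: measurable_funX.
    by apply: measurable_funD => //; exact: mAi.
  by apply/funext => y; rewrite eE.
have risk_ge v : (\sum_(i < N) \int[mu]_y (e i v y)%:E <= square_risk mu A (x v))%E.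
  have h := @nneseries_lim_ge R (fun i => \int[mu]_y (e i v y)%:E)%E xpredT 0 N.
  rewrite /square_risk integral_nneseries//.
  - rewrite big_mkord in h; apply: h => n _ _.
    by apply: integral_ge0 => y _; rewrite lee_fin.
  - by move=> n; exact: me.
  - by move=> n y _; rewrite lee_fin; exact: sqr_ge0.
apply: le_trans (leeD (risk_ge b) (risk_ge (- b))); rewrite -big_split/=.
have term i : ((2 * (diagonal_entry i ^+ 2 * (s ^+ 2 / 8)) +
     2 * (b ^+ 2 * d i ^+ 2))%:E <=
   \int[mu]_y (e i b y)%:E + \int[mu]_y (e i (- b) y)%:E)%E.
  rewrite -ge0_integralD//; last 2 first.
    by move=> y _; rewrite lee_fin.
    by move=> y _; rewrite lee_fin.
  have -> : (\int[mu]_y ((e i b y)%:E + (e i (- b) y)%:E) =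
     \int[mu]_y (2%:E * ((A y i) ^+ 2)%:E + (cst (2 * (b ^+ 2 * d i ^+ 2))%:E) y))%E.
    apply: eq_integral => y _; rewrite -EFinM -!EFinD !eE; congr (_%:E); ring.
  have mA2 : measurable_fun setT (fun y => ((A y i) ^+ 2)%:E).
    by apply/measurable_EFinP; apply: measurable_funX; exact: mAi.
  rewrite ge0_integralD//; last 3 first.
  - by move=> y _; rewrite -EFinM lee_fin; apply: mulr_ge0 (sqr_ge0 _).
  - exact: emeasurable_funM.
  - move=> y _; rewrite lee_fin; apply: mulr_ge0 => //.
    exact: mulr_ge0 (sqr_ge0 _) (sqr_ge0 _).
  have Ic (k : R) : (\int[mu]_y cst k%:E y = k%:E)%E.
    rewrite integral_cst// -[RHS]mule1; congr (_ * _)%E.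
    exact: (probability_setT mu).
  rewrite Ic ge0_integralZl_EFin//; last by move=> y _; rewrite lee_fin sqr_ge0.
  rewrite EFinD leeD2r// [X in (X <= _)%E]EFinM lee_wpmul2l//.
  exact: diagonal_entry_moment.
apply: (@le_trans _ _ (\sum_(i < N) (2 * (diagonal_entry i ^+ 2 * (s ^+ 2 / 8)) +
     2 * (b ^+ 2 * d i ^+ 2))%:E)%E); last by apply: lee_sum => i _; exact: term.
rewrite sumEFin lee_fin big_split/= -!mulr_sumr mulrDr lerD2l ler_wpM2l//.
rewrite ler_wpM2l ?sqr_ge0// (bigD1 (Ordinal jN))//= ler_wpDr//.
  by apply: sumr_ge0 => i _; exact: sqr_ge0.
by rewrite /d /basis_vec eqxx -sqrrN opprB.
Qed.

(** Let S be the supremum of the risk and V = s^2/8 sum_(i < N) A_ii^2.  The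
vertices give (1 - A_jj)^2 <= a_j^2 (S - V) for all j < N; summing over j,
s^2 sum_j (1 - A_jj)^2 <= S - V. *)
Lemma linear_risk_ge (X : set (nat -> R)) (a : nat -> R) N : (0 < N)%N ->
  (forall j, 0 < a j) -> (forall j v, `|v| * a j <= 1 -> X (basis_vec j v)) ->
  (\sum_(j < N) a j ^+ 2) * s ^+ 2 <= 1 ->
  ((N%:R * s ^+ 2 / 9)%:E <= ereal_sup [set square_risk mu A x | x in X])%E.
Proof.
move=> N0 a0 Xv aN; set S := ereal_sup _.
pose V := \sum_(i < N) diagonal_entry i ^+ 2 * (s ^+ 2 / 8).
have risk_vertex j : (j < N)%N ->
    ((V + (a j)^-1 ^+ 2 * (1 - diagonal_entry j) ^+ 2)%:E <= S)%E.
  move=> jN; have := square_risk_two_vertices (a j)^-1 jN; rewrite -/V.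
  have up v : `|v| * a j <= 1 -> (square_risk mu A (basis_vec j v) <= S)%E.
    by move=> /Xv Xjv; apply: ereal_sup_ubound; exists (basis_vec j v).
  have v1 : `|(a j)^-1| * a j <= 1 by rewrite gtr0_norm ?invr_gt0// mulVf ?gt_eqF.
  have v2 : `|- (a j)^-1| * a j <= 1 by rewrite normrN.
  move=> /le_trans /(_ (leeD (up _ v1) (up _ v2))).
  case: (S) => [r| |]//; rewrite ?leey// -EFinD !lee_fin; lra.
case: (S) risk_vertex => [r| |] risk_vertex; last 2 first.
- by rewrite leey.
- by have := risk_vertex _ N0.
rewrite lee_fin; have bias (j : 'I_N) :
    (1 - diagonal_entry j) ^+ 2 <= a j ^+ 2 * (r - V).
  have := risk_vertex _ (ltn_ord j); rewrite lee_fin => h.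
  have aj2 : 0 < a j ^+ 2 by rewrite exprn_gt0.
  by rewrite -ler_pdivrMl// -exprVn lerBrDl.
have rV : 0 <= r - V.
  have := risk_vertex _ N0; rewrite lee_fin; apply: contraLR; rewrite -!ltNge => h.
  apply: (@lt_le_trans _ _ V); first by rewrite -subr_lt0.
  by rewrite lerDl; exact: mulr_ge0 (sqr_ge0 _) (sqr_ge0 _).
have sumbias : \sum_(j < N) (1 - diagonal_entry j) ^+ 2 * s ^+ 2 <= r - V.
  rewrite -mulr_suml; apply: (@le_trans _ _ ((\sum_(j < N) a j ^+ 2) * (r - V) * s ^+ 2)).
    rewrite ler_wpM2r ?sqr_ge0// mulr_suml; apply: ler_sum => j _; exact: bias.
  by rewrite mulrAC ler_piMl.
apply: (@le_trans _ _ (\sum_(j < N) (diagonal_entry j ^+ 2 * (s ^+ 2 / 8) +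
     (1 - diagonal_entry j) ^+ 2 * s ^+ 2))); last by rewrite big_split/= -/V; lra.
rewrite -mulrA mulr_natl -[N in _ *+ N]card_ord -sumr_const; apply: ler_sum => j _.
(* The minimum of c^2 / 8 + (1 - c)^2 is 1/9, at c = 8/9. *)
rewrite -subr_ge0; move: (diagonal_entry j) => c.
have -> : c ^+ 2 * (s ^+ 2 / 8) + (1 - c) ^+ 2 * s ^+ 2 - s ^+ 2 / 9 =
  (9 * c - 8) ^+ 2 * s ^+ 2 / 72 by field.
by rewrite divr_ge0//; exact: mulr_ge0 (sqr_ge0 _) (sqr_ge0 _).
Qed.

End linear_lower_bound.

(** * Soft thresholding *)

Section soft_threshold.
Context {R : realType}.

Definition soft (t y : R) : R := y - Num.max (- t) (Num.min y t).

Lemma soft0 y : soft 0 y = y.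
Proof. by rewrite /soft oppr0 (max_idPl _) ?subr0// ge_min lexx orbT. Qed.

Lemma measurable_soft t : measurable_fun setT (soft t).
Proof.
apply: measurable_funB => //; apply: measurable_maxr => //.
exact: measurable_minr.
Qed.

(** The error is at most |x| and at most 2 t. *)
Lemma soft_err_small (t x z : R) : `|z| <= t -> (soft t (x + z) - x) ^+ 2 <= 2 * t * `|x|.
Proof.
rewrite ler_norml => /andP[z1 z2].
have x1 := ler_norm x; have x2 := ler_norm (- x); rewrite normrN in x2.
move: `|x| x1 x2 => ax x1 x2.
rewrite /soft; case: (leP (x + z) t) => h1.
  by case: (leP (- t) (x + z)) => h2; nra.
by case: (leP (- t) t) => h2; nra.
Qed.

Lemma soft_err_large (t x z : R) : 0 <= t -> t <= `|z| ->
  (soft t (x + z) - x) ^+ 2 <= 4 * z ^+ 2.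
Proof.
move=> t0 tz; rewrite -[z ^+ 2]real_normK ?num_real//.
have z1 := ler_norm z; have z2 := ler_norm (- z); rewrite normrN in z2.
have : `|soft t (x + z) - x| <= 2 * `|z|.
  move: `|z| z1 z2 tz => az z1 z2 tz.
  rewrite ler_norml /soft; case: (leP (x + z) t) => h1.
    by case: (leP (- t) (x + z)) => h2; apply/andP; split; lra.
  by case: (leP (- t) t) => h2; apply/andP; split; lra.
move=> h; rewrite -[leLHS]real_normK ?num_real//.
rewrite -[4](_ : 2 ^+ 2 = _); last by ring.
by rewrite -exprMn lerXn2r ?nnegrE ?mulr_ge0.
Qed.

(** On the event |z| > t the square of the noise is at most z^10 / t^8: a moment of
the noise bounds the tail, at the price of thresholds that are larger than the
usual logarithmic ones. *)
Lemma soft_err (t x z : R) : 0 < t ->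
  (soft t (x + z) - x) ^+ 2 <= 2 * t * `|x| + 4 * (z ^+ 10 / t ^+ 8).
Proof.
move=> t0; have z10 : 0 <= z ^+ 10 by rewrite exprn_even_ge0.
have t8 : 0 < t ^+ 8 by rewrite exprn_gt0.
have [zt|tz] := leP `|z| t.
  rewrite (le_trans (soft_err_small x zt))// lerDl mulr_ge0// divr_ge0//.
  exact: ltW.
rewrite (le_trans (soft_err_large x (ltW t0) (ltW tz)))//.
apply: (@le_trans _ _ (4 * (z ^+ 10 / t ^+ 8))); last first.
  by rewrite lerDr !mulr_ge0// ltW.
rewrite ler_wpM2l// ler_pdivlMr// (exprD z 2 8) ler_wpM2l ?sqr_ge0//.
have -> : z ^+ 8 = `|z| ^+ 8 by rewrite -normrX ger0_norm// exprn_even_ge0.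
by rewrite lerXn2r ?nnegrE ?(ltW t0) ?(ltW tz).
Qed.

Variables (s : R) (s0 : 0 < s) (mu : probability (seqspace R) R).
Hypothesis gmu : iid_gaussian s mu.

Lemma soft_coord_risk0 j (x : R) :
  (\int[mu]_y ((soft 0 (x + y j) - x) ^+ 2)%:E <= (8 * s ^+ 2)%:E)%E.
Proof.
under eq_integral do rewrite soft0 addrAC subrr add0r.
rewrite (ge0_integral_noise_coord gmu j (f := fun z => (z ^+ 2)%:E)); last 2 first.
- by apply/measurable_EFinP; exact: exprn_measurable.
- by move=> z; rewrite lee_fin sqr_ge0.
apply: le_trans (gaussian_even_moment_le 1 s0) _.
by rewrite lee_fin (_ : 1`!%N = 1%N)// expr1 mulr1 mulrA -natrM.
Qed.

(** Four times the bound 2 * 5! * 4^5 for the tenth moment of N(0, 1). *)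
Definition tail_const : R := 8 * 5`!%:R * 4 ^+ 5.

Lemma soft_coord_risk j (x t : R) : 0 < t ->
  (\int[mu]_y ((soft (s * t) (x + y j) - x) ^+ 2)%:E
    <= (2 * (s * t) * `|x| + tail_const * s ^+ 2 * (t ^+ 8)^-1)%:E)%E.
Proof.
move=> t0; have st0 : 0 < s * t by exact: mulr_gt0.
rewrite (ge0_integral_noise_coord gmu j
  (f := fun z => ((soft (s * t) (x + z) - x) ^+ 2)%:E)); last 2 first.
- apply/measurable_EFinP; apply: measurable_funX; apply: measurable_funB => //.
  by apply: measurableT_comp; [exact: measurable_soft|exact: measurable_funD].
- by move=> z; rewrite lee_fin sqr_ge0.
pose c := 4 / (s * t) ^+ 8.
have c0 : 0 <= c by rewrite divr_ge0// exprn_ge0// ltW.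
have m10 : measurable_fun [set: R] (fun z : R => (z ^+ 10)%:E).
  by apply/measurable_EFinP; exact: exprn_measurable.
have z10 (z : R) : 0 <= z ^+ 10 by rewrite exprn_even_ge0.
apply: (@le_trans _ _ (\int[normal_prob 0 s]_z
  ((cst (2 * (s * t) * `|x|)%:E) z + c%:E * (z ^+ 10)%:E))%E).
  apply: ge0_le_integral => //.
  - move=> z _; rewrite lee_fin; exact: sqr_ge0.
  - apply/measurable_EFinP; apply: measurable_funX; apply: measurable_funB => //.
    by apply: measurableT_comp; [exact: measurable_soft|exact: measurable_funD].
  - by apply: emeasurable_funD => //; exact: emeasurable_funM.
  - move=> z _; rewrite -EFinM -EFinD lee_fin /c.
    by rewrite [4 / _ * _]mulrAC -[4 * _ / _]mulrA soft_err.
rewrite ge0_integralD//; last 3 first.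
- by move=> z _; rewrite lee_fin !mulr_ge0// ltW.
- by move=> z _; rewrite -EFinM lee_fin mulr_ge0.
- exact: emeasurable_funM.
rewrite integral_cst// [X in (_ * X)%E]probability_setT mule1.
rewrite ge0_integralZl_EFin//; last by move=> z _; rewrite lee_fin.
rewrite EFinD leeD2l//.
apply: (le_trans (lee_wpmul2l _ (gaussian_even_moment_le 5 s0))) => //.
rewrite -EFinM lee_fin le_eqVlt; apply/orP; left; apply/eqP.
rewrite /c /tail_const; move: 5`!%:R => f.
by field; rewrite !gt_eqF.
Qed.

Definition threshold_estimator (m : nat) (t : nat -> R) (y : seqspace R)
    : seqspace R :=
  fun j => soft (if (j < m)%N then 0 else s * t j) (y j).

Lemma measurable_threshold_estimator m t : estimator (threshold_estimator m t).
Proof.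
apply: measurable_seqspaceP => j; rewrite /threshold_estimator.
exact: measurableT_comp (measurable_soft _) (measurable_noise_coord j).
Qed.

Lemma sum_indicator_le m n : \sum_(0 <= j < n) (if (j < m)%N then 1 else 0) <= m%:R :> R.
Proof.
apply: (@le_trans _ _ (minn n m)%:R); last by rewrite ler_nat geq_minr.
elim: n => [|n ih]; first by rewrite big_nil.
rewrite big_nat_recr//=; case: ltnP => nm.
  by rewrite (minn_idPl nm) -natr1 lerD2r (le_trans ih)// ler_nat geq_minl.
by rewrite addr0 (le_trans ih)// ler_nat leq_min geq_minr geq_min leqnSn.
Qed.

(** The first [m] coordinates contribute their variance.  For the others,
t_j |x_j| <= w a_j |x_j| sums to at most [w] over the ball, and the terms
t_j^-8 coming from large noise are summable. *)
Lemma threshold_estimator_risk (a t : nat -> R) m (w B : R) (x : nat -> R) :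
  (forall j, 1 <= a j) -> (forall j, 0 < t j) ->
  (forall j, (m <= j)%N -> t j <= w * a j) -> 0 <= w ->
  (forall n, \sum_(0 <= j < n) (t j ^+ 8)^-1 <= B) ->
  weighted_l1_ball a x ->
  (square_risk mu (threshold_estimator m t) x
   <= (8 * s ^+ 2 * m%:R + 2 * s * w + tail_const * s ^+ 2 * B)%:E)%E.
Proof.
move=> a1 t0 tw w0 tB xX.
pose e j (y : seqspace R) : R :=
  (soft (if (j < m)%N then 0 else s * t j) (x j + y j) - x j) ^+ 2.
have e0 j y : 0 <= e j y by exact: sqr_ge0.
have me j : measurable_fun setT (fun y => (e j y)%:E).
  apply/measurable_EFinP; apply: measurable_funX; apply: measurable_funB => //.
  apply: (measurableT_comp (measurable_soft _)); apply: measurable_funD => //.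
  exact: measurable_noise_coord.
have tail0 : 0 <= tail_const * s ^+ 2.
  by apply: mulr_ge0 (sqr_ge0 _); rewrite /tail_const !mulr_ge0// exprn_ge0.
have term j : (\int[mu]_y (e j y)%:E <=
    (8 * s ^+ 2 * (if (j < m)%N then 1 else 0) + 2 * s * w * (a j * `|x j|)
     + tail_const * s ^+ 2 * (t j ^+ 8)^-1)%:E)%E.
  have h1 : 0 <= 2 * s * w * (a j * `|x j|).
    by rewrite !mulr_ge0 ?(ltW s0)// (le_trans _ (a1 j)).
  have h2 : 0 <= tail_const * s ^+ 2 * (t j ^+ 8)^-1.
    by rewrite mulr_ge0// invr_ge0 exprn_ge0// ltW.
  rewrite /e; case: ltnP => jm.
    by rewrite (le_trans (soft_coord_risk0 _ _))// lee_fin mulr1 -addrA lerDl addr_ge0.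
  rewrite (le_trans (soft_coord_risk _ _ (t0 j)))// lee_fin mulr0 add0r lerD2r.
  have := ler_wpM2r (normr_ge0 (x j)) (tw j jm).
  rewrite -(ler_pM2l s0) -mulrA; lra.
rewrite /square_risk integral_nneseries//.
- apply: lime_le.
    apply: is_cvg_nneseries => j _ _.
    by apply: integral_ge0 => y _; rewrite lee_fin; exact: sqr_ge0.
  apply: nearW => n; apply: (le_trans (lee_sum _ (fun j _ => term j))).
  rewrite sumEFin lee_fin !big_split/= -!mulr_sumr.
  rewrite lerD//; last by rewrite ler_wpM2l.
  rewrite lerD//.
    by rewrite ler_wpM2l ?sum_indicator_le//; apply: mulr_ge0 (sqr_ge0 _).
  rewrite ler_piMr//; last exact: weighted_l1_ball_sum.
  by rewrite !mulr_ge0// ltW.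
by move=> n y _; rewrite lee_fin; exact: sqr_ge0.
Qed.

End soft_threshold.

(** * Comparison of the rates *)

Section power_weights.
Context {R : realType}.
Variables (alpha : R) (alpha1 : 1 < alpha).

Let alpha_gt0 : 0 < alpha. Proof. exact: lt_trans ltr01 alpha1. Qed.

Definition power_weight (j : nat) : R := j.+1%:R `^ (alpha / 2).

Lemma power_weight_ge1 j : 1 <= power_weight j.
Proof.
rewrite /power_weight -[leLHS](powRr0 j.+1%:R) ler_powR ?ler1n//.
by rewrite divr_ge0// ltW// alpha_gt0.
Qed.

Lemma power_weight_sq j : power_weight j ^+ 2 = j.+1%:R `^ alpha.
Proof. by rewrite -powR_mulrn ?powR_ge0// -powRrM divfK. Qed.

Lemma sum_power_weight_sq_le N (nu : R) : (N%:R <= nu) ->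
  \sum_(j < N) power_weight j ^+ 2 <= nu `^ (1 + alpha).
Proof.
move=> Nnu; have nu0 : 0 <= nu by exact: le_trans Nnu.
rewrite powRD; last by rewrite gt_eqF// addr_gt0// alpha_gt0.
rewrite powRr1//.
apply: (@le_trans _ _ (N%:R * nu `^ alpha)); last by rewrite ler_wpM2r ?powR_ge0.
rewrite mulr_natl -[N in leRHS]card_ord -sumr_const; apply: ler_sum => j _.
rewrite power_weight_sq ge0_ler_powR ?nnegrE// ?(ltW alpha_gt0)//.
by rewrite (le_trans _ Nnu)// ler_nat.
Qed.

Definition quarter_power (j : nat) : R := j.+1%:R `^ (1 / 4).

Lemma quarter_power_le m j : (0 < m)%N -> (m <= j)%N ->
  quarter_power j <= m%:R `^ (1 / 4 - alpha / 2) * power_weight j.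
Proof.
move=> m0 mj; have al1 := alpha1; rewrite /quarter_power /power_weight.
rewrite -{1}(subrK (alpha / 2) (1 / 4)) powRD; last by rewrite pnatr_eq0 implybT.
rewrite ler_wpM2r ?powR_ge0//.
rewrite -[1 / 4 - _]opprB !powRN lef_pV2 ?posrE ?powR_gt0 ?ltr0n//.
rewrite ge0_ler_powR ?nnegrE//; first lra.
by rewrite ler_nat leqW.
Qed.

(** The exponent 1/4 is chosen such that t_j^8 = j^2 has a summable inverse and
that t_j is negligible with respect to a_j, as alpha / 2 > 1/4. *)
Lemma sum_quarter_power8 n : \sum_(0 <= j < n) (quarter_power j ^+ 8)^-1 <= 2.
Proof.
apply: le_trans (le_trans (@sum_powRN_le R 2 n _) _); last 2 first.
- lra.
- by rewrite powR_mulrn// le_eqVlt; apply/orP; left; apply/eqP; field.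
rewrite le_eqVlt; apply/orP; left; apply/eqP; apply: eq_bigr => j _.
by rewrite -powR_mulrn ?powR_ge0// -powRrM; congr (_ `^ _)^-1; field.
Qed.

Lemma minimax_risk_le (s : R) (mu : probability (seqspace R) R) m :
  0 < s -> iid_gaussian s mu -> (0 < m)%N ->
  (minimax_risk mu (weighted_l1_ball power_weight) <=
   (8 * s ^+ 2 * m%:R + 2 * s * m%:R `^ (1 / 4 - alpha / 2)
     + tail_const * s ^+ 2 * 2)%:E)%E.
Proof.
move=> s0 gmu m0; apply: (@le_trans _ _ (ereal_sup
    [set square_risk mu (threshold_estimator s m quarter_power) x
    | x in weighted_l1_ball power_weight])).
  apply: ereal_inf_lbound; exists (threshold_estimator s m quarter_power) => //.
  exact: measurable_threshold_estimator.
apply: ge_ereal_sup => _ [x xX <-].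
apply: (threshold_estimator_risk s0 gmu (a := power_weight) _ _ _ _ _ xX).
- exact: power_weight_ge1.
- by move=> j; rewrite powR_gt0.
- by move=> j; exact: quarter_power_le.
- exact: powR_ge0.
- exact: sum_quarter_power8.
Qed.

Lemma minimax_risk_ge0 (mu : probability (seqspace R) R) :
  (0 <= minimax_risk mu (weighted_l1_ball power_weight))%E.
Proof.
apply: le_ereal_inf_tmp => _ [h _ <-].
apply: (@le_trans _ _ (square_risk mu h (basis_vec 0 0))).
  apply: integral_ge0 => y _; apply: nneseries_ge0 => j _ _.
  by rewrite lee_fin; exact: sqr_ge0.
apply: ereal_sup_ubound; exists (basis_vec 0 0) => //.
apply: weighted_l1_ball_basis_vec; last by rewrite normr0 mul0r.
by move=> j; exact: le_trans ler01 (power_weight_ge1 j).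
Qed.

Lemma linear_minimax_risk_ge (s : R) (mu : probability (seqspace R) R) N :
  0 < s -> iid_gaussian s mu -> (0 < N)%N ->
  N%:R `^ (1 + alpha) * s ^+ 2 <= 1 ->
  ((N%:R * s ^+ 2 / 9)%:E <= linear_minimax_risk mu (weighted_l1_ball power_weight))%E.
Proof.
move=> s0 gmu N0 Ns; apply: le_ereal_inf_tmp => _ [A linA <-].
apply: (linear_risk_ge s0 gmu linA (a := power_weight) N0).
- by move=> j; exact: lt_le_trans (power_weight_ge1 j).
- move=> j v; apply: weighted_l1_ball_basis_vec => i.
  exact: le_trans ler01 (power_weight_ge1 i).
- by apply: le_trans Ns; rewrite ler_wpM2r ?sqr_ge0// sum_power_weight_sq_le.
Qed.

Definition rate_exponent : R := (4 * alpha * (1 + alpha))^-1.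

Definition rate_const : R := 18 * (18 + 2 * tail_const).

(** With nu = s^(-2/(1+alpha)) one has s = nu^(-(1+alpha)/2), and the claim reduces
to inequalities between powers of nu >= 1.  For m about nu^(1 - 1/(2 alpha)) the
second term is of order s^2 nu^(1 - 1/(8 alpha)), and the other two are at most
of this order. *)
Lemma rate_comparison (s : R) : 0 < s <= 1 ->
  exists m N, [/\ (0 < m)%N, (0 < N)%N, N%:R `^ (1 + alpha) * s ^+ 2 <= 1
    & 8 * s ^+ 2 * m%:R + 2 * s * m%:R `^ (1 / 4 - alpha / 2)
        + tail_const * s ^+ 2 * 2
      <= rate_const * s `^ rate_exponent * (N%:R * s ^+ 2 / 9)].
Proof.
move=> /andP[s0 s1]; have al0 := alpha_gt0; have al1 := alpha1.
have a10 : 0 < 1 + alpha by lra.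
pose q : R := -2 / (1 + alpha).
pose nu := s `^ q.
have nu_ge1 : 1 <= nu.
  rewrite -[leLHS](powRr0 s) ger_powR ?s0//.
  by rewrite /q mulNr oppr_le0 divr_ge0// ltW.
have nu0 : 0 < nu by exact: lt_le_trans nu_ge1.
have nuX r : nu `^ r = s `^ (q * r) by rewrite /nu -powRrM.
pose nu' := nu `^ (1 - (2 * alpha)^-1).
have nu'_ge1 : 1 <= nu'.
  rewrite -[leLHS](powRr0 nu) ler_powR// subr_ge0 invf_le1 ?mulr_gt0//; lra.
have nu'_gt0 : 0 < nu' by exact: lt_le_trans nu'_ge1.
exists (Num.truncn nu').+1, (Num.truncn nu).
have /andP[N1 N2] := truncn_itv (ltW nu0).
have /andP[m1 m2] := truncn_itv (ltW nu'_gt0).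
have N0 : (0 < Num.truncn nu)%N by rewrite truncn_gt0.
move: (Num.truncn nu) N0 N1 N2 => N N0 N1 N2.
have m3 : (Num.truncn nu').+1%:R <= 2 * nu' by rewrite -natr1; lra.
move: (Num.truncn nu').+1 (ltn0Sn (Num.truncn nu')) m2 m3 => m m0 m2 m3.
set p := s `^ rate_exponent.
have p0 : 0 < p by rewrite powR_gt0.
have pE : p = nu `^ (- (8 * alpha)^-1).
  rewrite nuX; congr (_ `^ _); rewrite /rate_exponent /q.
  by field; rewrite !gt_eqF.
have sE : s = nu `^ (- (1 + alpha) / 2).
  rewrite nuX -[LHS]powRr1 ?(ltW s0)//; congr (_ `^ _); rewrite /q.
  by field; rewrite !gt_eqF.
have nuE : nu = nu `^ 1 by rewrite powRr1// ltW.
have nuD r t : nu `^ r * nu `^ t = nu `^ (r + t).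
  by rewrite powRD// (gt_eqF nu0) implybT.
have a8 : 0 < (8 * alpha)^-1 by rewrite invr_gt0 mulr_gt0.
have a28 : (2 * alpha)^-1 = 4 * (8 * alpha)^-1 by field; rewrite gt_eqF.
have key1 : nu' <= nu * p.
  by rewrite {1}nuE pE nuD ler_powR//; lra.
have key2 : m%:R `^ (1 / 4 - alpha / 2) <= nu * s * p.
  apply: (@le_trans _ _ (nu' `^ (1 / 4 - alpha / 2))).
    rewrite -[1 / 4 - _]opprB !powRN lef_pV2 ?posrE ?powR_gt0 ?ltr0n//.
    by rewrite ge0_ler_powR ?nnegrE ?(ltW nu'_gt0) ?(ltW m2)//; lra.
  rewrite {1}nuE sE pE !nuD /nu' -powRrM ler_powR// le_eqVlt; apply/orP; left.
  by apply/eqP; field; rewrite gt_eqF.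
have key3 : 1 <= nu * p by exact: le_trans key1.
split => //.
  apply: (@le_trans _ _ (nu `^ (1 + alpha) * s ^+ 2)).
    by rewrite ler_wpM2r ?sqr_ge0// ge0_ler_powR ?nnegrE ?(ltW a10) ?(ltW nu0).
  rewrite nuX (_ : q * (1 + alpha) = - 2%:R); last first.
    by rewrite /q; field; rewrite gt_eqF.
  by rewrite powR_invn ?(ltW s0)// mulVf// gt_eqF// exprn_gt0.
have T0 : 0 <= tail_const :> R by rewrite /tail_const !mulr_ge0// exprn_ge0.
have x0 : 0 < s ^+ 2 by rewrite exprn_gt0.
have h1 : 8 * s ^+ 2 * m%:R <= 16 * s ^+ 2 * (nu * p).
  have h : m%:R <= 2 * (nu * p) by lra.
  by have := ler_wpM2l (ltW x0) h; lra.
have h2 : 2 * s * m%:R `^ (1 / 4 - alpha / 2) <= 2 * s ^+ 2 * (nu * p).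
  have := ler_wpM2l (ltW s0) key2; rewrite expr2; lra.
have h3 : tail_const * s ^+ 2 * 2 <= 2 * tail_const * s ^+ 2 * (nu * p).
  have := ler_wpM2l (mulr_ge0 T0 (ltW x0)) key3; lra.
have h4 : (18 + 2 * tail_const) * s ^+ 2 * (nu * p) <=
          (18 + 2 * tail_const) * s ^+ 2 * (2 * N%:R * p).
  have c0 : 0 <= 18 + 2 * tail_const :> R by lra.
  apply: ler_wpM2l; first by rewrite mulr_ge0// ltW.
  rewrite ler_pM2r//; have := N2; rewrite -natr1.
  have : 1 <= N%:R :> R by rewrite ler1n.
  lra.
rewrite /rate_const; lra.
Qed.

Lemma risk_ratio_le (s : R) (mu : probability (seqspace R) R) :
  0 < s <= 1 -> iid_gaussian s mu ->
  (0 <= minimax_risk mu (weighted_l1_ball power_weight) /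
        linear_minimax_risk mu (weighted_l1_ball power_weight)
     <= (rate_const * s `^ rate_exponent)%:E)%E.
Proof.
move=> s01 gmu; set X := weighted_l1_ball power_weight; have /andP[s0 s1] := s01.
have [m [N [m0 N0 Ns hU]]] := rate_comparison s01.
have U := minimax_risk_le s0 gmu m0; have L := linear_minimax_risk_ge s0 gmu N0 Ns.
have M0 := minimax_risk_ge0 mu.
set l := N%:R * s ^+ 2 / 9 in hU L.
have l0 : 0 < l by rewrite divr_gt0// mulr_gt0 ?ltr0n ?exprn_gt0.
have L0 : (0 <= linear_minimax_risk mu X)%E.
  by apply: le_trans L; rewrite lee_fin ltW.
apply/andP; split; first by rewrite mule_ge0// inve_ge0.
have Linv : ((linear_minimax_risk mu X)^-1 <= (l^-1)%:E)%E.
  have -> : (l^-1)%:E = (l%:E)^-1%E by rewrite inver gt_eqF.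
  by rewrite lee_pV2// inE// lee_fin ltW.
have c0 : (0 <= (linear_minimax_risk mu X)^-1)%E by rewrite inve_ge0.
have U' : (minimax_risk mu X <= (rate_const * s `^ rate_exponent * l)%:E)%E.
  by apply: le_trans U _; rewrite lee_fin.
apply: (le_trans (lee_pmul M0 c0 U' Linv)).
by rewrite -EFinM lee_fin mulfK// gt_eqF.
Qed.

Lemma risk_ratio_cvg0 (mu : R -> probability (seqspace R) R) :
  (forall s, 0 < s -> iid_gaussian s (mu s)) ->
  let X := weighted_l1_ball power_weight in
  (minimax_risk (mu s) X / linear_minimax_risk (mu s) X)%E @[s --> 0^'+] --> 0%E.
Proof.
move=> gmu X; have al0 := alpha_gt0.
apply: (@squeeze_cvge _ _ _ _ (cst 0%E) _
  (fun s => (rate_const * s `^ rate_exponent)%:E)).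
- near=> s; apply: risk_ratio_le; last by apply: gmu; near: s; exact: nbhs_right_gt.
  apply/andP; split; near: s; first exact: nbhs_right_gt.
  exact: nbhs_right_le.
- exact: cvg_cst.
- apply: cvg_EFin; first exact: nearW.
  rewrite -[X in _ --> X](mulr0 rate_const).
  apply: (@cvgMr _ R); apply: powR_cvg0.
  by rewrite invr_gt0 !mulr_gt0// addr_gt0.
Unshelve. all: by end_near.
Qed.

Lemma gradient_method_optimal : exists C : R, forall k : nat, (0 < k)%N ->
  exists lambda : nat -> R, admissible_scaling lambda /\
    (worst_case_regret (weighted_l1_ball power_weight) lambda k <=
     C%:E * minimax_stochastic (weighted_l1_ball power_weight) k)%E.
Proof.
pose B : R := (1 - 2 / 2 `^ alpha)^-1.
have sumB n : \sum_(0 <= j < n) (power_weight j ^+ 2)^-1 <= B.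
  apply: le_trans (sum_powRN_le n alpha1); rewrite le_eqVlt; apply/orP; left.
  by apply/eqP; apply: eq_bigr => j _; rewrite power_weight_sq.
have B0 : 0 <= B by apply: le_trans (sumB 0%N); rewrite big_nil.
exists (8 * (1 + B)) => k k0.
have r0 : 0 < Num.sqrt k%:R :> R by rewrite sqrtr_gt0 ltr0n.
have rk : (Num.sqrt k%:R) ^+ 2 = k%:R :> R by rewrite sqr_sqrtr.
exists (fun j => Num.sqrt k%:R * power_weight j ^+ 2); split.
  exact: (admissible_scaling_sq power_weight_ge1 sumB).
apply: (le_trans (worst_case_regret_le power_weight_ge1 sumB r0 k0)).
have Xe v : `|v| <= 1 -> weighted_l1_ball power_weight (basis_vec 0 v).
  move=> v1; apply: weighted_l1_ball_basis_vec.
    by move=> i; exact: le_trans ler01 (power_weight_ge1 i).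
  by rewrite /power_weight powR1 mulr1.
apply: (@le_trans _ _ ((8 * (1 + B))%:E * (16 * Num.sqrt k%:R)^-1%:E)%E).
  rewrite -EFinM lee_fin; move: rk r0; move: (Num.sqrt k%:R) => r <- r0.
  by rewrite le_eqVlt; apply/orP; left; apply/eqP; field; rewrite gt_eqF.
rewrite lee_wpmul2l ?lee_fin//; last exact: minimax_stochastic_ge.
by rewrite mulr_ge0// addr_ge0.
Qed.

End power_weights.

Theorem corollary11 (R : realType) (alpha : R) (halpha : 1 < alpha) :
  let a : nat -> R := fun j => j.+1%:R `^ (alpha / 2) in
  let X : set (nat -> R) := weighted_l1_ball a in
  (forall mu : R -> probability (seqspace R) R,
     (forall sigma, 0 < sigma -> iid_gaussian sigma (mu sigma)) ->
     (minimax_risk (mu sigma) X / linear_minimax_risk (mu sigma) X)%E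
       @[sigma --> 0^'+] --> 0%E)
  /\
  (exists C : R, forall k : nat, (0 < k)%N ->
     exists lambda : nat -> R,
       admissible_scaling lambda /\
       (worst_case_regret X lambda k <= C%:E * minimax_stochastic X k)%E).
Proof.
move=> a X; split; last exact: gradient_method_optimal.
by move=> mu gmu; exact: risk_ratio_cvg0.
Qed.
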